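(* Let $\mathbb{G}$ be a Lie 2-group, $(\pi:\mathbb{E}\to\mathbb{X},\mathcal{C})$ a quasi-principal $\mathbb{G}$-bundle over a Lie groupoid $\mathbb{X}$ with a strict connection $\omega:T\mathbb{E}\to L(\mathbb{G})$, and suppose there is a left action of $\mathbb{G}$ on a 2-vector space $\mathbb{V}$. Then, given a path $\alpha$ from $x$ to $y$ in $X_0$, there is an isomorphism of 2-vector spaces $$T^{\alpha}_{\omega,\mathbb{V}}:(\pi^{\mathbb{V}})^{-1}(x)\to(\pi^{\mathbb{V}})^{-1}(y),\qquad[p,v]\mapsto[\mathrm{Tr}^{\alpha}_{\omega_0}(p),v],\qquad[\delta,\zeta]\mapsto[\mathrm{Tr}^{u\circ\alpha}_{\omega_1}(\delta),\zeta].$$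
   Context: In a Lie groupoid $\mathbb{X}=[X_1\rightrightarrows X_0]$, $s,t$ are source and target and $u:x\mapsto 1_x$ is the unit map. Morphisms of Lie groupoids are smooth functors. A (strict) Lie 2-group $\mathbb{G}=[G_1\rightrightarrows G_0]$ is a Lie groupoid with a smooth functor $\mathbb{G}\times\mathbb{G}\to\mathbb{G}$ giving Lie group structures on $G_0$ and $G_1$. Paths are smooth maps on $[0,1]$ with sitting instants (constant near $0$ and near $1$). A principal $\mathbb{G}$-bundle over $\mathbb{X}$ is a morphism of Lie groupoids $\pi:\mathbb{E}=[E_1\rightrightarrows E_0]\to\mathbb{X}$ with a right action of $\mathbb{G}$ on $\mathbb{E}$ (a smooth functor $\mathbb{E}\times\mathbb{G}\to\mathbb{E}$, a Lie group action on objects and on morphisms) such that $\pi_0:E_0\to X_0$ and $\pi_1:E_1\to X_1$ are principal $G_0$- and $G_1$-bundles. A quasi connection is a smooth map $\mathcal{C}:X_1\times_{s,X_0,\pi_0}E_0\to E_1$ with $s(\mathcal{C}(\gamma,p))=p$, $\pi_1(\mathcal{C}(\gamma,p))=\gamma$ and $\mathcal{C}(\gamma,pg)=\mathcal{C}(\gamma,p)1_g$; $(\pi,\mathcal{C})$ is then a quasi-principal $\mathbb{G}$-bundle. $T\mathbb{E}=[TE_1\rightrightarrows TE_0]$ and $L(\mathbb{G})=[L(G_1)\rightrightarrows L(G_0)]$ have structure maps given by differentials. A strict connection is a morphism of Lie groupoids $\omega=(\omega_1,\omega_0):T\mathbb{E}\to L(\mathbb{G})$, equivariant for the differential of the $\mathbb{G}$-action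 and the adjoint action, with $\omega_i$ an $L(G_i)$-valued 1-form on $E_i$ satisfying $\omega_i(\delta_p(B))=B$, where $\delta_p(B)$ is the vertical vector generated by $B\in L(G_i)$ at $p\in E_i$ (so $\omega_i$ is a connection 1-form on $E_i\to X_i$). $\mathrm{Tr}^{\beta}_{\omega_i}$ is the classical parallel transport along a path $\beta$ in $X_i$. A 2-vector space $\mathbb{V}=[V_1\rightrightarrows V_0]$ is a category internal to finite-dimensional real vector spaces; morphisms of 2-vector spaces are functors that are linear on objects and on morphisms. A left action of $\mathbb{G}$ on $\mathbb{V}$ is a functor $\rho:\mathbb{G}\times\mathbb{V}\to\mathbb{V}$ such that $\rho_i:G_i\times V_i\to V_i$ are left Lie group actions inducing linear representations of $G_i$ on $V_i$, $i=0,1$. The associated VB-groupoid $\pi^{\mathbb{V}}:\frac{\mathbb{E}\times\mathbb{V}}{\mathbb{G}}=\left[\frac{E_1\times V_1}{G_1}\rightrightarrows\frac{E_0\times V_0}{G_0}\right]\to\mathbb{X}$ has as its levels the usual associated vector bundles (quotients of $E_i\times V_i$ by $(p,v)\sim(pg,g^{-1}v)$, $g\in G_i$). Its structure maps are induced by those of $\mathbb{E}$ and $\mathbb{V}$, and its projection is $[p,v]\mapsto\pi_i(p)$. Its fibre over $x\in X_0$ is the 2-vector space $(\pi^{\mathbb{V}})^{-1}(x)=[(\pi_1^{\mathbb{V}})^{-1}(1_x)\rightrightarrows(\pi_0^{\mathbb{V}})^{-1}(x)]$. *)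

(* Defs.v *)
From HB Require Import structures.
From mathcomp Require Import all_boot all_order all_algebra.
From mathcomp Require Import lra.
From mathcomp Require Import all_classical all_reals topology normedtype derive.

Set Implicit Arguments.
Unset Strict Implicit.
Unset Printing Implicit Defensive.

Import Order.TTheory GRing.Theory Num.Theory.
Import numFieldNormedType.Exports.

Local Open Scope classical_set_scope.
Local Open Scope ring_scope.

Section SmoothCoordinates.
Variables (R : realType) (n : nat).

(* U is meant to be open.  C^k through continuity of all iterated directional
   derivatives up to order k; this also covers n = 0. *)
Fixpoint Ck_on (k : nat) (U : set 'rV[R]_n) (f : 'rV[R]_n -> R) : Prop :=
  (forall x, U x -> {for x, continuous f}) /\
  (if k is k'.+1 then
     forall v, (forall x, U x -> derivable f x v) /\
               Ck_on k' U (fun x => 'D_v f x)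
   else True).

Definition Cinfty_on (U : set 'rV[R]_n) (f : 'rV[R]_n -> R) : Prop :=
  forall k, Ck_on k U f.

End SmoothCoordinates.

(* chart_fun and chart_inv are total; only their restrictions to chart_dom and to
   its image are meaningful. *)
Record chart (R : realType) (T : topologicalType) (n : nat) := Chart {
  chart_dom : set T;
  chart_fun :> T -> 'rV[R]_n;
  chart_inv : 'rV[R]_n -> T;
  chart_dom_open : open chart_dom;
  chart_img_open : open (chart_fun @` chart_dom);
  chart_invK : forall p, chart_dom p -> chart_inv (chart_fun p) = p;
  chart_cont : forall p, chart_dom p -> {for p, continuous chart_fun};
  chart_inv_cont : forall x, (chart_fun @` chart_dom) x ->
    {for x, continuous chart_inv} }.

Definition chart_img (R : realType) (T : topologicalType) n
  (phi : chart R T n) : set 'rV[R]_n := phi @` chart_dom phi.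

Definition chart_compatible (R : realType) (T : topologicalType) n
    (phi psi : chart R T n) : Prop :=
  forall j, Cinfty_on
    [set x | chart_img phi x /\ chart_dom psi (chart_inv phi x)]
    (fun x => psi (chart_inv phi x) 0 j).

(* Smooth manifolds without boundary, of constant dimension mdim.  chart_at selects
   a chart around each point; through it the tangent space at p is identified with
   'rV[R]_(mdim M), where M is the manifold. *)
HB.mixin Record isManifold (R : realType) M of Topological M := {
  mdim : nat;
  atlas : set (chart R M mdim);
  chart_at : M -> chart R M mdim;
  chart_at_atlas : forall p, atlas (chart_at p);
  chart_at_dom : forall p, chart_dom (chart_at p) p;
  atlas_compatible : forall phi psi, atlas phi -> atlas psi ->
    chart_compatible phi psi;
  manifold_hausdorff : hausdorff_space M;
  manifold_second_countable : @second_countable M }.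

#[short(type="manifoldType")]
HB.structure Definition Manifold (R : realType) :=
  { M of Topological M & isManifold R M }.

Arguments mdim {R} M : rename.

Section SmoothnessLemmas.
Variable R : realType.

Lemma cvg_mxP (T : Type) (F : set_system T) {FF : Filter F} m n
    (f : T -> 'M[R]_(m, n)) (A : 'M[R]_(m, n)) :
  (forall i j, (fun t => f t i j) @ F --> A i j) -> f @ F --> A.
Proof.
move=> fA B [P nP PB].
suff FP : \forall t \near F, forall i j, P i j (f t i j).
  by apply: filterS FP => t Pt; apply: PB => i j.
by apply: filter_forall => i; apply: filter_forall => j; exact: (fA i j _ (nP i j)).
Qed.

Lemma lsubmx_continuous n1 n2 :
  continuous (lsubmx : 'rV[R]_(n1 + n2) -> 'rV[R]_n1).
Proof.
move=> x; apply: (cvg_mxP (F := nbhs x)) => i j.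
have -> : (fun t : 'rV[R]_(n1 + n2) => lsubmx t i j) =
          (fun t => t i (lshift n2 j)) by apply/funext => t; rewrite mxE.
by rewrite mxE; exact: coord_continuous.
Qed.

Lemma rsubmx_continuous n1 n2 :
  continuous (rsubmx : 'rV[R]_(n1 + n2) -> 'rV[R]_n2).
Proof.
move=> x; apply: (cvg_mxP (F := nbhs x)) => i j.
have -> : (fun t : 'rV[R]_(n1 + n2) => rsubmx t i j) =
          (fun t => t i (rshift n1 j)) by apply/funext => t; rewrite mxE.
by rewrite mxE; exact: coord_continuous.
Qed.

Lemma Cinfty_on_sub n (U V : set 'rV[R]_n) f :
  U `<=` V -> Cinfty_on V f -> Cinfty_on U f.
Proof.
move=> UV fV k; move: f {fV}(fV k); elim: k => [|k IH] f /= [cf df].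
  by split => // x /UV /cf.
split=> [x /UV /cf //|v]; have [d1 d2] := df v.
by split; [move=> x /UV /d1|exact: IH].
Qed.

Lemma Cinfty_on_comp_linear n m (L : {linear 'rV[R]_n -> 'rV[R]_m})
    (Lc : continuous L) (U : set 'rV[R]_m) f :
  Cinfty_on U f -> Cinfty_on (L @^-1` U) (f \o L).
Proof.
move=> fU k; move: f {fU}(fU k).
have E (f : 'rV[R]_m -> R) x v :
  (fun h : R => h^-1 *: (((f \o L) \o shift x) (h *: v) - (f \o L) x)) =
  (fun h : R => h^-1 *: ((f \o shift (L x)) (h *: L v) - f (L x))).
  by apply/funext => h /=; congr (_ *: (f _ - _)); exact: linearP.
have D (f : 'rV[R]_m -> R) v :
    (fun x => 'D_v (f \o L) x) = (fun x => 'D_(L v) f x) \o L.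
  by apply/funext => x; rewrite /derive E.
have C (f : 'rV[R]_m -> R) : (forall x, U x -> {for x, continuous f}) ->
    forall x, (L @^-1` U) x -> {for x, continuous (f \o L)}.
  by move=> cf x Ux; apply: continuous_comp; [exact: Lc|exact: cf].
elim: k => [|k IH] f /= [cf df]; split; [exact: C|by []|exact: C|move=> v].
have [d1 d2] := df (L v); split; first by move=> x /d1; rewrite /derivable E.
by rewrite D; exact: IH.
Qed.

Lemma Ck_on_cst n k (U : set 'rV[R]_n) (c : R) : Ck_on k U (fun=> c).
Proof.
elim: k c => [|k IH] c /=; (split; first by move=> x _; exact: cst_continuous) => //.
move=> v; split; first by move=> x _; exact: derivable_cst.
suff -> : (fun x => 'D_v (fun=> c) x) = (fun=> 0) :> ('rV[R]_n -> R) by exact: IH.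
by apply/funext => x; rewrite derive_cst.
Qed.

Lemma Cinfty_on_coord n (U : set 'rV[R]_n) j : Cinfty_on U (fun x => x 0 j).
Proof.
have E x v : (fun h : R => h^-1 *: (((fun y : 'rV[R]_n => y 0 j) \o shift x)
    (h *: v) - x 0 j)) @ 0^' --> v 0 j.
  have : (fun=> v 0 j) @ (0 : R)^' --> v 0 j by exact: cvg_cst.
  apply: cvg_trans; apply: near_eq_cvg; near=> h => /=.
  rewrite !mxE addrK scalerA mulVf ?scale1r //.
  by near: h; exact: nbhs_dnbhs_neq.
case=> [|k] /=; (split; first by move=> x _; exact: coord_continuous) => //.
move=> v; split.
  by move=> x _; apply/cvg_ex; exists (v 0 j); exact: E.
suff -> : (fun x => 'D_v (fun y : 'rV[R]_n => y 0 j) x) = (fun=> v 0 j).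
  exact: Ck_on_cst.
by apply/funext => x; apply/cvg_lim => //; exact: E.
Unshelve. all: by end_near. Qed.

End SmoothnessLemmas.

Section GlobalChart.
Variables (R : realType) (T : topologicalType) (n : nat).
Variables (f : T -> 'rV[R]_n) (g : 'rV[R]_n -> T).
Hypotheses (fK : cancel f g) (gK : cancel g f).
Hypotheses (fc : continuous f) (gc : continuous g).

Let f_img : f @` setT = setT.
Proof. by apply/seteqP; split=> // x _; exists (g x). Qed.

Fact global_chart_img_open : open (f @` setT).
Proof. by rewrite f_img; exact: openT. Qed.

Definition global_chart : chart R T n :=
  @Chart R T n setT f g openT global_chart_img_open (fun p _ => fK p)
    (fun p _ => @fc p) (fun x _ => @gc x).

Fact global_chart_compatible phi psi :
  [set global_chart] phi -> [set global_chart] psi -> chart_compatible phi psi.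
Proof.
move=> -> -> j /=.
have -> : (fun x => f (g x) 0 j) = (fun x => x 0 j) by apply/funext => x; rewrite gK.
exact: Cinfty_on_coord.
Qed.

End GlobalChart.

Section SecondCountable.

Lemma second_countable_prod (T U : topologicalType) :
  @second_countable T -> @second_countable U -> @second_countable (T * U)%type.
Proof.
move=> [B cB [oB bB]] [C cC [oC bC]].
exists [set A | exists2 z, (B `*` C) z & A = z.1 `*` z.2].
  have -> : [set A | exists2 z, (B `*` C) z & A = z.1 `*` z.2] =
      (fun z : set T * set U => z.1 `*` z.2) @` (B `*` C).
    by apply/seteqP; split=> A [z zBC e]; exists z.
  by apply: sub_countable (card_image_le _ _) _; exact: countableX.
split=> [A [[b c] [/= Bb Cc] ->]|[x y] A [[P Q] /= [Px Qy] PQA]].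
  rewrite openE => -[x y] [/= bx cy]; exists (b, c) => //=.
  by split; apply: open_nbhs_nbhs; split=> //; [exact: oB|exact: oC].
have [b [Bb bx] bP] := bB x P Px; have [c [Cc cy] cQ] := bC y Q Qy.
exists (b `*` c) => [|[u v] [/= bu cv]]; first by split=> //; exists (b, c).
by apply: PQA; split; [exact: bP|exact: cQ].
Qed.

Lemma second_countable_R (R : realType) : @second_countable R.
Proof.
exists [set A | exists q : rat * rat, A = `]ratr q.1, ratr q.2[%classic].
  have -> : [set A : set R | exists q : rat * rat, A = `]ratr q.1, ratr q.2[%classic] =
    (fun q : rat * rat => `]ratr q.1, ratr q.2[%classic : set R) @` setT.
    by apply/seteqP; split=> A [q]; [move=> ->; exists q|move=> _ <-; exists q].
  by apply: sub_countable (card_image_le _ _) _; exact: countableP.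
split=> [A [q ->]|x A /nbhs_ballP[e /= e0 xA]]; first exact: interval_open.
have [p] : exists p, ratr p \in `]x - e, x[.
  by apply: rat_in_itvoo; rewrite ltrBlDr ltrDl.
rewrite in_itv /= => /andP[xp px].
have [q] : exists q, ratr q \in `]x, x + e[ by apply: rat_in_itvoo; rewrite ltrDl.
rewrite in_itv /= => /andP[xq qx].
exists `]ratr p, ratr q[%classic => [|y /=].
  by split; [exists (p, q)|rewrite /= in_itv /= px xq].
rewrite in_itv /= => /andP[py yq]; apply: xA; rewrite /ball /= ltr_norml; lra.
Qed.

Lemma second_countable_mx (T : topologicalType) m n :
  @second_countable T -> @second_countable 'M[T]_(m, n).
Proof.
move=> [B cB [oB bB]].
pose box (P : 'I_m -> 'I_n -> set T) : set 'M[T]_(m, n) :=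
  [set M | forall i j, P i j (M i j)].
have [h hB] : exists h : nat -> set T, B `<=` range h.
  have /countable_injP[c ic] := cB.
  exists (fun k => xget set0 [set b | B b /\ c b = k]) => b Bb.
  exists (c b) => //; case: xgetP => [b' _ [Bb' e]|/(_ b) []//].
  by apply: ic => //; rewrite inE.
exists [set A | exists2 k : 'M[nat]_(m, n), (forall i j, B (h (k i j))) &
    A = box (fun i j => h (k i j))].
  apply: sub_countable (countableP (setT : set 'M[nat]_(m, n))).
  apply: card_le_trans (card_image_le (fun k : 'M[nat]_(m, n) => box (fun i j => h (k i j))) setT).
  by apply: subset_card_le => A [k _ ->]; exists k.
split=> [A [k Bk ->]|M A [P nP PA]].
  rewrite openE => M boxM; exists (fun i j => h (k i j)) => // i j.
  by apply: open_nbhs_nbhs; split; [exact: oB|exact: boxM].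
have /choice[b bP] (ij : 'I_m * 'I_n) : exists k, [/\ B (h k), h k (M ij.1 ij.2) &
    h k `<=` P ij.1 ij.2].
  have [U [BU UM] UP] := bB (M ij.1 ij.2) _ (nP ij.1 ij.2).
  by have [k _ hk] := hB _ BU; exists k; rewrite hk.
exists (box (fun i j => h ((\matrix_(i, j) b (i, j)) i j))) => [|N boxN].
  split=> [|i j]; last by rewrite mxE; case: (bP (i, j)).
  by exists (\matrix_(i, j) b (i, j)) => // i j; rewrite mxE; case: (bP (i, j)).
apply: PA => i j; case: (bP (i, j)) => _ _; apply.
by have := boxN i j; rewrite mxE.
Qed.

End SecondCountable.

Section EuclideanManifolds.
Variables (R : realType).

Fact const_mx_continuous : continuous (const_mx : R -> 'rV[R]_1).
Proof.
move=> x; apply: (cvg_mxP (F := nbhs x)) => i j; rewrite mxE.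
have -> : (fun t : R => (const_mx t : 'rV[R]_1) i j) = id by apply/funext => t; rewrite mxE.
exact: cvg_id.
Qed.

Fact const_mxK : cancel (const_mx : R -> 'rV[R]_1) (fun v => v 0 0).
Proof. by move=> x; rewrite mxE. Qed.

Fact const_mxVK : cancel (fun v : 'rV[R]_1 => v 0 0) const_mx.
Proof. by move=> v; apply/rowP => j; rewrite mxE ord1. Qed.

Let real_chart := global_chart const_mxK const_mxVK const_mx_continuous
  (@coord_continuous R 1 1 0 0).

HB.instance Definition _ := @isManifold.Build R R^o 1 [set real_chart]
  (fun=> real_chart) (fun=> erefl) (fun=> I) (@global_chart_compatible _ _ _ _ _ _ _ _ _)
  (@Rhausdorff R) (second_countable_R R).

Variable n : nat.

Let rV_chart := global_chart (fun v : 'rV[R]_n => erefl v) (fun v => erefl v)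
  (fun v => cvg_id) (fun v => cvg_id).

HB.instance Definition _ := @isManifold.Build R 'rV[R]_n n [set rV_chart]
  (fun=> rV_chart) (fun=> erefl) (fun=> I) (@global_chart_compatible _ _ _ _ _ _ _ _ _)
  (@norm_hausdorff _ _) (second_countable_mx 1 n (second_countable_R R)).

End EuclideanManifolds.

Section ProductManifold.
Variable R : realType.

Section ProductChart.
Variables (T U : topologicalType) (m n : nat).
Variables (phi : chart R T m) (psi : chart R U n).

Definition prod_chart_fun (z : T * U) : 'rV[R]_(m + n) := row_mx (phi z.1) (psi z.2).
Definition prod_chart_inv (x : 'rV[R]_(m + n)) : T * U :=
  (chart_inv phi (lsubmx x), chart_inv psi (rsubmx x)).

Let dom := chart_dom phi `*` chart_dom psi.

Fact prod_chart_img : prod_chart_fun @` dom =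
  [set x | chart_img phi (lsubmx x) /\ chart_img psi (rsubmx x)].
Proof.
apply/seteqP; split=> [_ [[p q] [/= dp dq] <-]|x [/= [p dp px] [q dq qx]]].
  by rewrite /prod_chart_fun /= row_mxKl row_mxKr; split; [exists p|exists q].
by exists (p, q) => //; rewrite /prod_chart_fun /= px qx hsubmxK.
Qed.

Fact prod_chart_dom_open : open dom.
Proof.
rewrite openE => -[p q] [/= dp dq]; exists (chart_dom phi, chart_dom psi) => //=.
by split; apply: open_nbhs_nbhs; split=> //; exact: chart_dom_open.
Qed.

Fact prod_chart_img_open : open (prod_chart_fun @` dom).
Proof.
rewrite prod_chart_img; apply: openI.
  apply: (@open_comp _ _ (@lsubmx R 1 m n) (chart_img phi)).
    by move=> x _; exact: lsubmx_continuous.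
  exact: chart_img_open.
apply: (@open_comp _ _ (@rsubmx R 1 m n) (chart_img psi)).
  by move=> x _; exact: rsubmx_continuous.
exact: chart_img_open.
Qed.

Fact prod_chart_invK p : dom p -> prod_chart_inv (prod_chart_fun p) = p.
Proof.
case: p => p q [/= dp dq]; rewrite /prod_chart_inv /prod_chart_fun /=.
by rewrite row_mxKl row_mxKr !chart_invK.
Qed.

Fact prod_chart_cont p : dom p -> {for p, continuous prod_chart_fun}.
Proof.
case: p => p q [/= dp dq].
have c1 : {for (p, q), continuous (phi \o fst)}.
  by apply: continuous_comp; [exact: cvg_fst|exact: chart_cont].
have c2 : {for (p, q), continuous (psi \o snd)}.
  by apply: continuous_comp; [exact: cvg_snd|exact: chart_cont].
apply: (cvg_mxP (F := nbhs (p, q))) => i j.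
rewrite (ord1 i) -(splitK j); case: (fintype.split j) => k /=.
  have -> : (fun z => prod_chart_fun z 0 (lshift n k)) =
    (fun x : 'rV[R]_m => x 0 k) \o (phi \o fst) by apply/funext => z /=; rewrite row_mxEl.
  rewrite row_mxEl; apply: continuous_comp; first exact: c1.
  exact: coord_continuous.
have -> : (fun z => prod_chart_fun z 0 (rshift m k)) =
    (fun x : 'rV[R]_n => x 0 k) \o (psi \o snd) by apply/funext => z /=; rewrite row_mxEr.
rewrite row_mxEr; apply: continuous_comp; first exact: c2.
exact: coord_continuous.
Qed.

Fact prod_chart_inv_cont x : (prod_chart_fun @` dom) x ->
  {for x, continuous prod_chart_inv}.
Proof.
rewrite prod_chart_img => -[dp dq]; apply: (cvg_pair (F := nbhs x)).
  by apply: continuous_comp; [exact: lsubmx_continuous|exact: chart_inv_cont].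
by apply: continuous_comp; [exact: rsubmx_continuous|exact: chart_inv_cont].
Qed.

Definition prod_chart : chart R (T * U)%type (m + n) :=
  Chart prod_chart_dom_open prod_chart_img_open prod_chart_invK
    prod_chart_cont prod_chart_inv_cont.

End ProductChart.

Lemma prod_chart_compatible (T U : topologicalType) m n
    (phi phi' : chart R T m) (psi psi' : chart R U n) :
  chart_compatible phi phi' -> chart_compatible psi psi' ->
  chart_compatible (prod_chart phi psi) (prod_chart phi' psi').
Proof.
move=> cphi cpsi j; rewrite -(splitK j); case: (fintype.split j) => k /=.
  have -> : (fun x => prod_chart_fun phi' psi' (prod_chart_inv phi psi x) 0 (lshift n k)) =
    (fun x => phi' (chart_inv phi x) 0 k) \o @lsubmx R 1 m n.
    by apply/funext => x; rewrite /= row_mxEl.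
  apply: Cinfty_on_sub
    (Cinfty_on_comp_linear (L := @lsubmx R 1 m n) (@lsubmx_continuous R m n) (cphi k)).
  by move=> x /= [xi [xd _]]; move: xi; rewrite /chart_img prod_chart_img => -[].
have -> : (fun x => prod_chart_fun phi' psi' (prod_chart_inv phi psi x) 0 (rshift m k)) =
  (fun x => psi' (chart_inv psi x) 0 k) \o @rsubmx R 1 m n.
  by apply/funext => x; rewrite /= row_mxEr.
apply: Cinfty_on_sub
  (Cinfty_on_comp_linear (L := @rsubmx R 1 m n) (@rsubmx_continuous R m n) (cpsi k)).
by move=> x /= [xi [_ xd]]; move: xi; rewrite /chart_img prod_chart_img => -[].
Qed.

Variables (M N : manifoldType R).

Let prod_atlas : set (chart R (M * N)%type (mdim M + mdim N)) :=
  [set Phi | exists2 z, (atlas `*` atlas) z & Phi = prod_chart z.1 z.2].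

Fact prod_manifold_hausdorff : hausdorff_space (M * N)%type.
Proof.
move=> [p q] [p' q'] pq; congr pair.
  apply: (@manifold_hausdorff R M) => A B Ap Bp.
  have [||z [Az Bz]] := pq (A `*` setT) (B `*` setT).
  - by exists (A, setT) => //=; split=> //; exact: filterT.
  - by exists (B, setT) => //=; split=> //; exact: filterT.
  - by exists z.1; case: Az; case: Bz.
apply: (@manifold_hausdorff R N) => A B Ap Bp.
have [||z [Az Bz]] := pq (setT `*` A) (setT `*` B).
- by exists (setT, A) => //=; split=> //; exact: filterT.
- by exists (setT, B) => //=; split=> //; exact: filterT.
- by exists z.2; case: Az; case: Bz.
Qed.

Fact prod_atlas_compatible Phi Psi :
  prod_atlas Phi -> prod_atlas Psi -> chart_compatible Phi Psi.
Proof.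
move=> [z [z1 z2] ->] [w [w1 w2] ->].
by apply: prod_chart_compatible; exact: atlas_compatible.
Qed.

HB.instance Definition _ := @isManifold.Build R (M * N)%type (mdim M + mdim N)
  prod_atlas (fun z => prod_chart (chart_at z.1) (chart_at z.2))
  (fun z => ex_intro2 _ _ (chart_at z.1, chart_at z.2)
     (conj (chart_at_atlas z.1) (chart_at_atlas z.2)) erefl)
  (fun z => conj (chart_at_dom z.1) (chart_at_dom z.2))
  prod_atlas_compatible prod_manifold_hausdorff
  (second_countable_prod manifold_second_countable manifold_second_countable).

End ProductManifold.

Section SmoothMaps.
Variables (R : realType) (M N : manifoldType R).

Definition smooth_open (W : set M) (f : M -> N) : Prop :=
  (forall p, W p -> {for p, continuous f}) /\
  (forall phi psi, atlas phi -> atlas psi -> forall j, Cinfty_on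
     [set x | [/\ chart_img phi x, W (chart_inv phi x)
                & chart_dom psi (f (chart_inv phi x))]]
     (fun x => psi (f (chart_inv phi x)) 0 j)).

(* Smoothness on an arbitrary subset S, by local smooth extension.  When S is an
   embedded submanifold, such as a fibre product along a submersion, this is
   smoothness for the submanifold structure. *)
Definition smooth_on (S : set M) (f : M -> N) : Prop :=
  forall p, S p -> exists W g,
    [/\ open W, W p, smooth_open W g & forall q, W q -> S q -> g q = f q].

Definition smooth (f : M -> N) : Prop := smooth_open setT f.

(* The differential T_p M -> T_(f p) N, read in the charts selected by chart_at. *)
Definition tdiff (f : M -> N) (p : M) :
    {linear 'rV[R]_(mdim M) -> 'rV[R]_(mdim N)} :=
  'd (chart_at (f p) \o f \o chart_inv (chart_at p)) (chart_at p p).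

Definition submersion (f : M -> N) : Prop :=
  smooth f /\ forall p w, exists v, tdiff f p v = w.

Definition velocity (c : R -> M) (t : R) : 'rV[R]_(mdim M) :=
  derive1 (chart_at (c t) \o c) t.

(* Smoothness of a vector-valued 1-form: its coefficients in every chart are smooth;
   'd (...) x v is the tangent vector whose coordinates in phi are v. *)
Definition smooth_form (k : nat)
    (om : M -> {linear 'rV[R]_(mdim M) -> 'rV[R]_k}) : Prop :=
  forall phi, atlas phi -> forall v j, Cinfty_on (chart_img phi)
    (fun x => om (chart_inv phi x)
      ('d (chart_at (chart_inv phi x) \o chart_inv phi) x v) 0 j).

End SmoothMaps.

Section Paths.
Variables (R : realType) (M : manifoldType R).

Definition smooth_path (alpha : R -> M) : Prop :=
  smooth_on (M := R^o) [set t : R^o | 0 <= t <= 1] alpha.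

(* Paths have sitting instants; only the values of alpha on [0, 1] matter. *)
Definition path_from_to (alpha : R -> M) (x y : M) : Prop :=
  smooth_path alpha /\
  exists2 e : R, 0 < e < 1 &
    (forall t, 0 <= t <= e -> alpha t = x) /\
    (forall t, 1 - e <= t <= 1 -> alpha t = y).

Definition smooth_curve (c : R -> M) : Prop := smooth (M := R^o) c.

End Paths.

HB.mixin Record isLieGroup (R : realType) G of Manifold R G & Group G := {
  smooth_mulg : smooth (fun z : (G * G)%type => (z.1 * z.2)%g);
  smooth_invg : smooth (fun g : G => g^-1%g) }.

#[short(type="lieGroupType")]
HB.structure Definition LieGroup (R : realType) :=
  { G of Manifold R G & Group G & isLieGroup R G }.

Section LieGroupTheory.
Variables (R : realType) (G : lieGroupType R).

(* The Lie algebra is the tangent space at 1, i.e. 'rV[R]_(mdim G). *)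
Definition Ad (g : G) (B : 'rV[R]_(mdim G)) : 'rV[R]_(mdim G) :=
  tdiff (fun h : G => (g * h * g^-1)%g) 1%g B.

(* Smoothness of G x V -> V, with V identified with a coordinate space by a basis. *)
Record lie_rep (V : vectType R) := LieRep {
  rep_map :> G -> {linear V -> V};
  rep1 : forall v, rep_map 1%g v = v;
  repM : forall g h v, rep_map (g * h)%g v = rep_map g (rep_map h v);
  rep_smooth : smooth (fun z : (G * 'rV[R]_(\dim {:V}))%type =>
    passmx.rVof (vbasis {:V}) (rep_map z.1 (passmx.vecof (vbasis {:V}) z.2))) }.

End LieGroupTheory.

(* gcomp g h is g after h; its values are irrelevant unless gsrc g = gtgt h. *)
Record groupoid_on (R : realType) (X1 X0 : manifoldType R) := GroupoidOn {
  gsrc : X1 -> X0;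
  gtgt : X1 -> X0;
  gunit : X0 -> X1;
  gcomp : X1 -> X1 -> X1;
  ginv : X1 -> X1;
  gsrc_unit : forall x, gsrc (gunit x) = x;
  gtgt_unit : forall x, gtgt (gunit x) = x;
  gsrc_comp : forall g h, gsrc g = gtgt h -> gsrc (gcomp g h) = gsrc h;
  gtgt_comp : forall g h, gsrc g = gtgt h -> gtgt (gcomp g h) = gtgt g;
  gcompA : forall g h k, gsrc g = gtgt h -> gsrc h = gtgt k ->
    gcomp g (gcomp h k) = gcomp (gcomp g h) k;
  gcomp1g : forall g, gcomp (gunit (gtgt g)) g = g;
  gcompg1 : forall g, gcomp g (gunit (gsrc g)) = g;
  gsrc_inv : forall g, gsrc (ginv g) = gtgt g;
  gtgt_inv : forall g, gtgt (ginv g) = gsrc g;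
  gcompVg : forall g, gcomp (ginv g) g = gunit (gsrc g);
  gcompgV : forall g, gcomp g (ginv g) = gunit (gtgt g);
  gsrc_submersion : submersion gsrc;
  gtgt_submersion : submersion gtgt;
  gunit_smooth : smooth gunit;
  ginv_smooth : smooth ginv;
  gcomp_smooth :
    smooth_on [set z : (X1 * X1)%type | gsrc z.1 = gtgt z.2]
      (fun z => gcomp z.1 z.2) }.

Record lie_groupoid (R : realType) := LieGroupoid {
  arr : manifoldType R;
  obj : manifoldType R;
  groupoid_str :> groupoid_on arr obj }.

Record groupoid_functor (R : realType) (A1 A0 B1 B0 : manifoldType R)
    (A : groupoid_on A1 A0) (B : groupoid_on B1 B0)
    (f1 : A1 -> B1) (f0 : A0 -> B0) : Prop := GroupoidFunctor {
  functor_smooth1 : smooth f1;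
  functor_smooth0 : smooth f0;
  functor_src : forall g, gsrc B (f1 g) = f0 (gsrc A g);
  functor_tgt : forall g, gtgt B (f1 g) = f0 (gtgt A g);
  functor_unit : forall x, f1 (gunit A x) = gunit B (f0 x);
  functor_comp : forall g h, gsrc A g = gtgt A h ->
    f1 (gcomp A g h) = gcomp B (f1 g) (f1 h) }.

(* Composition in the tangent groupoid, i.e. u = (dm)_(g, h)(v, w), where m is the
   composition on the fibre product X1 x_(X0) X1, evaluated on a curve in the fibre
   product with velocity (v, w).  Taken at units of a 2-group it is the composition
   of L(G). *)
Definition tangent_comp (R : realType) (X1 X0 : manifoldType R)
    (X : groupoid_on X1 X0) (g h : X1) (v w u : 'rV[R]_(mdim X1)) : Prop :=
  exists a b : R -> X1,
    [/\ smooth_curve a /\ smooth_curve b,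
        forall t, gsrc X (a t) = gtgt X (b t),
        a 0 = g /\ velocity a 0 = v,
        b 0 = h /\ velocity b 0 = w &
        velocity (fun t => gcomp X (a t) (b t)) 0 = u].

Record lie_2group (R : realType) := Lie2Group {
  arrg : lieGroupType R;
  objg : lieGroupType R;
  two_group_str :> groupoid_on arrg objg;
  src_mulg : {morph gsrc two_group_str : a b / (a * b)%g};
  tgt_mulg : {morph gtgt two_group_str : a b / (a * b)%g};
  unit_mulg : {morph gunit two_group_str : a b / (a * b)%g};
  comp_mulg : forall a a' b b',
    gsrc two_group_str a = gtgt two_group_str a' ->
    gsrc two_group_str b = gtgt two_group_str b' ->
    gcomp two_group_str (a * b)%g (a' * b')%g =
    (gcomp two_group_str a a' * gcomp two_group_str b b')%g }.

Arguments src_mulg {R} l.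
Arguments tgt_mulg {R} l.
Arguments unit_mulg {R} l.

(* In pb_loctriv, p |-> (pb_proj p, tau p) is an equivariant diffeomorphism from the
   part over U to U x G, with inverse sigma. *)
Record principal_bundle (R : realType) (P M : manifoldType R)
    (G : lieGroupType R) := PrincipalBundle {
  pb_proj : P -> M;
  pb_act : P -> G -> P;
  pb_proj_smooth : smooth pb_proj;
  pb_act_smooth : smooth (fun z : (P * G)%type => pb_act z.1 z.2);
  pb_act1 : forall p, pb_act p 1%g = p;
  pb_actM : forall p g h, pb_act p (g * h)%g = pb_act (pb_act p g) h;
  pb_proj_act : forall p g, pb_proj (pb_act p g) = pb_proj p;
  pb_loctriv : forall x : M, exists (U : set M) (tau : P -> G) (sigma : M * G -> P),
    [/\ open U /\ U x,
        smooth_open (pb_proj @^-1` U) tau /\ smooth_open (U `*` setT) sigma,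
        forall p, U (pb_proj p) -> sigma (pb_proj p, tau p) = p,
        forall y g, U y -> pb_proj (sigma (y, g)) = y /\ tau (sigma (y, g)) = g &
        forall p g, U (pb_proj p) -> tau (pb_act p g) = (tau p * g)%g] }.

Record principal_2bundle (R : realType) (G : lie_2group R) (X : lie_groupoid R) :=
    Principal2Bundle {
  arrE : manifoldType R;
  objE : manifoldType R;
  two_bundle_str :> groupoid_on arrE objE;
  bundle1 : principal_bundle arrE (arr X) (arrg G);
  bundle0 : principal_bundle objE (obj X) (objg G);
  proj_functor : groupoid_functor two_bundle_str X (pb_proj bundle1) (pb_proj bundle0);
  src_act : forall d g, gsrc two_bundle_str (pb_act bundle1 d g) =
    pb_act bundle0 (gsrc two_bundle_str d) (gsrc G g);
  tgt_act : forall d g, gtgt two_bundle_str (pb_act bundle1 d g) =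
    pb_act bundle0 (gtgt two_bundle_str d) (gtgt G g);
  unit_act : forall p g, gunit two_bundle_str (pb_act bundle0 p g) =
    pb_act bundle1 (gunit two_bundle_str p) (gunit G g);
  comp_act : forall d d' g g',
    gsrc two_bundle_str d = gtgt two_bundle_str d' -> gsrc G g = gtgt G g' ->
    gcomp two_bundle_str (pb_act bundle1 d g) (pb_act bundle1 d' g') =
    pb_act bundle1 (gcomp two_bundle_str d d') (gcomp G g g') }.

Record quasi_connection (R : realType) (G : lie_2group R) (X : lie_groupoid R)
    (E : principal_2bundle G X) := QuasiConnection {
  qc_map :> arr X -> objE E -> arrE E;
  qc_smooth : smooth_on
    [set z : (arr X * objE E)%type | gsrc X z.1 = pb_proj (bundle0 E) z.2]
    (fun z => qc_map z.1 z.2);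
  qc_src : forall gam p, gsrc X gam = pb_proj (bundle0 E) p ->
    gsrc E (qc_map gam p) = p;
  qc_proj : forall gam p, gsrc X gam = pb_proj (bundle0 E) p ->
    pb_proj (bundle1 E) (qc_map gam p) = gam;
  qc_act : forall gam p g, gsrc X gam = pb_proj (bundle0 E) p ->
    qc_map gam (pb_act (bundle0 E) p g) =
    pb_act (bundle1 E) (qc_map gam p) (gunit G g) }.

Section Connections.
Variables (R : realType) (P M : manifoldType R) (G : lieGroupType R).
Variable B : principal_bundle P M G.

(* In cf_vertical the differential is that of the orbit map of p at 1; its values lie
   in the tangent space at pb_act B p 1 = p. *)
Record connection_form := ConnectionForm {
  cf_form :> P -> {linear 'rV[R]_(mdim P) -> 'rV[R]_(mdim G)};
  cf_smooth : smooth_form cf_form;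
  cf_equivariant : forall p g v,
    cf_form (pb_act B p g) (tdiff (fun q => pb_act B q g) p v) =
    Ad (g^-1)%g (cf_form p v);
  cf_vertical : forall p b, cf_form p (tdiff (fun g : G => pb_act B p g) 1%g b) = b }.

Variable om : connection_form.

Definition horizontal_lift (beta : R -> M) (c : R -> P) : Prop :=
  [/\ smooth_path c,
      forall t, 0 <= t <= 1 -> pb_proj B (c t) = beta t &
      forall t, 0 < t < 1 -> om (c t) (velocity c t) = 0].

(* The end point of the horizontal lift starting at p. *)
Definition transport (beta : R -> M) (p : P) : P :=
  xget p [set q | exists c, [/\ horizontal_lift beta c, c 0 = p & c 1 = q]].

End Connections.

(* The last four fields say that (om1, om0) is a functor from the tangent groupoid
   of E to L(G), whose structure maps are differentials at the identities. *)
Record strict_connection (R : realType) (G : lie_2group R) (X : lie_groupoid R)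
    (E : principal_2bundle G X) := StrictConnection {
  om1 : connection_form (bundle1 E);
  om0 : connection_form (bundle0 E);
  om_src : forall d v,
    tdiff (gsrc G) 1%g (om1 d v) = om0 (gsrc E d) (tdiff (gsrc E) d v);
  om_tgt : forall d v,
    tdiff (gtgt G) 1%g (om1 d v) = om0 (gtgt E d) (tdiff (gtgt E) d v);
  om_unit : forall p v,
    om1 (gunit E p) (tdiff (gunit E) p v) = tdiff (gunit G) 1%g (om0 p v);
  om_comp : forall d d' v w u, tangent_comp E d d' v w u ->
    tangent_comp G 1%g 1%g (om1 d v) (om1 d' w) (om1 (gcomp E d d') u) }.

(* As for groupoids, vcomp is only meaningful on composable pairs; vcomp_linear is
   linearity on the subspace of these pairs. *)
Record two_vect (R : realType) := TwoVect {
  arrv : vectType R;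
  objv : vectType R;
  vsrc : {linear arrv -> objv};
  vtgt : {linear arrv -> objv};
  vunit : {linear objv -> arrv};
  vcomp : arrv -> arrv -> arrv;
  vsrc_unit : forall x, vsrc (vunit x) = x;
  vtgt_unit : forall x, vtgt (vunit x) = x;
  vsrc_comp : forall a b, vsrc a = vtgt b -> vsrc (vcomp a b) = vsrc b;
  vtgt_comp : forall a b, vsrc a = vtgt b -> vtgt (vcomp a b) = vtgt a;
  vcompA : forall a b c, vsrc a = vtgt b -> vsrc b = vtgt c ->
    vcomp a (vcomp b c) = vcomp (vcomp a b) c;
  vcomp1v : forall a, vcomp (vunit (vtgt a)) a = a;
  vcompv1 : forall a, vcomp a (vunit (vsrc a)) = a;
  vcomp_linear : forall (k : R) a b a' b', vsrc a = vtgt b -> vsrc a' = vtgt b' ->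
    vcomp (k *: a + a') (k *: b + b') = k *: vcomp a b + vcomp a' b' }.

Arguments vcomp {R} t.

Section TwoVectorSpaceMorphisms.
Variable R : realType.

Record two_vect_mor (V W : two_vect R) := TwoVectMor {
  mor1 : {linear arrv V -> arrv W};
  mor0 : {linear objv V -> objv W};
  mor_src : forall a, vsrc W (mor1 a) = mor0 (vsrc V a);
  mor_tgt : forall a, vtgt W (mor1 a) = mor0 (vtgt V a);
  mor_unit : forall x, mor1 (vunit V x) = vunit W (mor0 x);
  mor_comp : forall a b, vsrc V a = vtgt V b ->
    mor1 (vcomp V a b) = vcomp W (mor1 a) (mor1 b) }.

Definition two_vect_iso (V W : two_vect R) (F : two_vect_mor V W) : Prop :=
  exists F' : two_vect_mor W V,
    [/\ cancel (mor1 F) (mor1 F'), cancel (mor1 F') (mor1 F),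
        cancel (mor0 F) (mor0 F') & cancel (mor0 F') (mor0 F)].

End TwoVectorSpaceMorphisms.

Record two_rep (R : realType) (G : lie_2group R) (V : two_vect R) := TwoRep {
  trep1 : lie_rep (arrg G) (arrv V);
  trep0 : lie_rep (objg G) (objv V);
  trep_src : forall g v, vsrc V (trep1 g v) = trep0 (gsrc G g) (vsrc V v);
  trep_tgt : forall g v, vtgt V (trep1 g v) = trep0 (gtgt G g) (vtgt V v);
  trep_unit : forall g v, trep1 (gunit G g) (vunit V v) = vunit V (trep0 g v);
  trep_comp : forall g g' v v', gsrc G g = gtgt G g' -> vsrc V v = vtgt V v' ->
    trep1 (gcomp G g g') (vcomp V v v') = vcomp V (trep1 g v) (trep1 g' v') }.

Lemma can2_vect_axiom (K : fieldType) (V : vectType K) (W : lmodType K)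
    (f : W -> V) (g : V -> W) :
  linear f -> cancel f g -> cancel g f -> Vector.axiom (\dim {:V}) W.
Proof.
have vb := vbasisP {:V}.
move=> lf fK gK; exists (passmx.rVof (vbasis {:V}) \o f) => [k a b /=|].
  by rewrite lf passmx.rVof_linear.
exists (g \o passmx.vecof (vbasis {:V})) => [w|r] /=.
  by rewrite passmx.rVofK ?fK.
by rewrite gK passmx.vecofK.
Qed.

Section AssociatedBundle.
Variables (R : realType) (P M : manifoldType R) (G : lieGroupType R).
Variables (B : principal_bundle P M G) (V : vectType R) (rho : lie_rep G V).

Definition assoc_eqv (z w : P * V) : bool :=
  `[< exists g : G, w = (pb_act B z.1 g, rho (g^-1)%g z.2) >].

Fact assoc_eqv_refl : reflexive assoc_eqv.
Proof. by case=> p v; apply/asboolP; exists 1%g; rewrite pb_act1 invg1 rep1. Qed.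

Fact assoc_eqv_trans : transitive assoc_eqv.
Proof.
move=> w z x /asboolP[g ->] /asboolP[h ->]; apply/asboolP; exists (g * h)%g => /=.
by rewrite pb_actM invgM repM.
Qed.

Fact assoc_eqv_sym : symmetric assoc_eqv.
Proof.
suff S z w : assoc_eqv z w -> assoc_eqv w z by move=> z w; apply/idP/idP; exact: S.
case: z => p v /asboolP[g ->]; apply/asboolP; exists (g^-1)%g => /=.
by rewrite -pb_actM mulgV pb_act1 -repM mulVg rep1.
Qed.

Canonical assoc_equiv := EquivRel assoc_eqv assoc_eqv_refl assoc_eqv_sym assoc_eqv_trans.

Definition assoc := {eq_quot assoc_equiv}%qT.
HB.instance Definition _ := Choice.on assoc.
HB.instance Definition _ := EqQuotient.on assoc.

Definition acls (p : P) (v : V) : assoc := \pi_assoc%qT (p, v).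

Lemma aclsP p v q w :
  acls p v = acls q w <-> exists g : G, q = pb_act B p g /\ w = rho (g^-1)%g v.
Proof.
split=> [/eqmodP /asboolP[g [-> ->]]|[g [-> ->]]]; first by exists g.
by apply/eqmodP/asboolP; exists g.
Qed.

Lemma acls_repr (a : assoc) : a = acls (repr a).1 (repr a).2.
Proof. by rewrite /acls -surjective_pairing reprK. Qed.

Definition aproj (a : assoc) : M := pb_proj B (repr a).1.

Lemma aprojE p v : aproj (acls p v) = pb_proj B p.
Proof.
rewrite /aproj; have /aclsP[g [-> _]] := acls_repr (acls p v).
exact: pb_proj_act.
Qed.


Lemma pb_surj x : exists p, pb_proj B p = x.
Proof.
have [U [tau [sigma [[_ Ux] _ _ s1 _]]]] := pb_loctriv B x.
by exists (sigma (x, 1%g)); case: (s1 x 1%g Ux).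
Qed.

Lemma pb_free p g h : pb_act B p g = pb_act B p h -> g = h.
Proof.
have [U [tau [sigma [[_ Ux] _ _ _ s2]]]] := pb_loctriv B (pb_proj B p).
by move=> /(congr1 tau); rewrite !s2 // => /mulgI.
Qed.

Lemma pb_transitive p q : pb_proj B p = pb_proj B q -> exists g, q = pb_act B p g.
Proof.
move=> pq; have [U [tau [sigma [[_ Ux] _ s0 _ s2]]]] := pb_loctriv B (pb_proj B p).
exists ((tau p)^-1 * tau q)%g.
have Uq : U (pb_proj B q) by rewrite -pq.
by rewrite -[LHS](s0 q Uq) -[RHS]s0 ?pb_proj_act // (s2 p) // mulVKg pq.
Qed.

Definition afib (x : M) := {a : assoc | aproj a == x}.
HB.instance Definition _ x := Choice.on (afib x).

Section Fibre.
Variable x : M.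

Definition fcls p v (h : pb_proj B p = x) : afib x :=
  exist _ (acls p v) (introT eqP (etrans (aprojE p v) h)).

Lemma val_fcls p v h : val (@fcls p v h) = acls p v. Proof. by []. Qed.

Lemma fclsP p v w (h h' : pb_proj B p = x) : fcls v h = fcls w h' <-> v = w.
Proof.
split=> [/(congr1 val) /aclsP[g [pg ->]]|->]; last exact: val_inj.
have -> : g = 1%g by apply: (@pb_free p); rewrite -pg pb_act1.
by rewrite invg1 rep1.
Qed.

Lemma fcls_surj p (h : pb_proj B p = x) (a : afib x) : exists v, a = fcls v h.
Proof.
case: a => a ax; have := acls_repr a; case: (repr a) => q w /= aE.
have qx : pb_proj B q = x by rewrite -(aprojE q w) -aE; exact/eqP.
have [g pg] : exists g, p = pb_act B q g by apply: pb_transitive; rewrite qx h.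
by exists (rho (g^-1)%g w); apply: val_inj; rewrite /= aE; apply/aclsP; exists g.
Qed.

(* The vector space structure is transported from V by v |-> [fbase, v]; by
   fcls_linear it does not depend on the base point: [p, v] + [p, w] = [p, v + w]. *)
Definition fbase : P := projT1 (cid (pb_surj x)).
Lemma fbaseP : pb_proj B fbase = x. Proof. exact: (projT2 (cid (pb_surj x))). Qed.

Definition fmk (v : V) : afib x := fcls v fbaseP.
Definition fcoord (a : afib x) : V := projT1 (cid (fcls_surj fbaseP a)).

Lemma fcoordK : cancel fcoord fmk.
Proof. by move=> a; rewrite /fcoord; case: cid. Qed.
Lemma fmkK : cancel fmk fcoord.
Proof. by move=> v; have /fclsP := fcoordK (fmk v). Qed.

Definition fzero : afib x := fmk 0.
Definition fopp (a : afib x) : afib x := fmk (- fcoord a).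
Definition fadd (a b : afib x) : afib x := fmk (fcoord a + fcoord b).
Definition fscale (k : R) (a : afib x) : afib x := fmk (k *: fcoord a).

Fact faddA : associative fadd.
Proof. by move=> a b c; rewrite /fadd !fmkK addrA. Qed.
Fact faddC : commutative fadd.
Proof. by move=> a b; rewrite /fadd addrC. Qed.
Fact fadd0 : left_id fzero fadd.
Proof. by move=> a; rewrite /fadd fmkK add0r fcoordK. Qed.
Fact faddN : left_inverse fzero fopp fadd.
Proof. by move=> a; rewrite /fadd fmkK addNr. Qed.
HB.instance Definition _ := GRing.isZmodule.Build (afib x) faddA faddC fadd0 faddN.

Fact fscaleA k l a : fscale k (fscale l a) = fscale (k * l) a.
Proof. by rewrite /fscale fmkK scalerA. Qed.
Fact fscale1 : left_id 1 fscale.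
Proof. by move=> a; rewrite /fscale scale1r fcoordK. Qed.
Fact fscaleDr : right_distributive fscale +%R.
Proof.
move=> k a b; change (fscale k (fadd a b) = fadd (fscale k a) (fscale k b)).
by rewrite /fscale /fadd !fmkK scalerDr.
Qed.
Fact fscaleDl a : {morph fscale^~ a : k l / k + l}.
Proof.
move=> k l; change (fscale (k + l) a = fadd (fscale k a) (fscale l a)).
by rewrite /fscale /fadd !fmkK scalerDl.
Qed.
HB.instance Definition _ := GRing.Zmodule_isLmodule.Build R (afib x)
  fscaleA fscale1 fscaleDr fscaleDl.

Fact fmk_linear : linear fmk.
Proof.
move=> k v w; change (fmk (k *: v + w) = fadd (fscale k (fmk v)) (fmk w)).
by rewrite /fadd /fscale !fmkK.
Qed.
HB.instance Definition _ := GRing.isLinear.Build R V (afib x) _ fmk fmk_linear.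

Fact fcoord_linear : linear fcoord.
Proof.
move=> k a b; apply: (can_inj fmkK).
by rewrite [RHS]linearP /= !fcoordK.
Qed.
HB.instance Definition _ := GRing.isLinear.Build R (afib x) V _ fcoord fcoord_linear.

Fact afib_vect_axiom : Vector.axiom (\dim {:V}) (afib x).
Proof. exact: (can2_vect_axiom fcoord_linear fcoordK fmkK). Qed.
HB.instance Definition _ := Lmodule_hasFinDim.Build R (afib x) afib_vect_axiom.

Lemma fcls_linear p (h : pb_proj B p = x) : linear (fun v => fcls v h).
Proof.
have [g pg] : exists g, fbase = pb_act B p g by apply: pb_transitive; rewrite h fbaseP.
have E v : fcls v h = fmk (rho (g^-1)%g v).
  by apply: val_inj; apply/aclsP; exists g.
by move=> k v w; rewrite !E linearP fmk_linear.
Qed.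

End Fibre.
End AssociatedBundle.

Section TwoGroupLemmas.
Variables (R : realType) (G : lie_2group R).

Lemma morphM1 (A B : groupType) (f : A -> B) :
  {morph f : a b / (a * b)%g} -> f 1%g = 1%g.
Proof. by move=> fM; apply: (mulgI (f 1%g)); rewrite -fM !mulg1. Qed.

Lemma morphMV (A B : groupType) (f : A -> B) :
  {morph f : a b / (a * b)%g} -> {morph f : a / (a^-1)%g}.
Proof.
by move=> fM a; apply: (mulgI (f a)); rewrite -fM !mulgV (morphM1 fM).
Qed.

Lemma comp_invg (a b : arrg G) : gsrc G a = gtgt G b ->
  gcomp G (a^-1)%g (b^-1)%g = ((gcomp G a b)^-1)%g.
Proof.
move=> ab; apply: (mulgI (gcomp G a b)); rewrite -comp_mulg //; last first.
  by rewrite (morphMV (src_mulg G)) (morphMV (tgt_mulg G)) ab.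
rewrite !mulgV -{1}(morphM1 (unit_mulg G)) -(gtgt_unit G 1%g).
by rewrite (morphM1 (unit_mulg G)) gcomp1g.
Qed.

End TwoGroupLemmas.

Section AssociatedGroupoid.
Variables (R : realType) (G : lie_2group R) (X : lie_groupoid R).
Variables (E : principal_2bundle G X) (V : two_vect R) (rho : two_rep G V).

Local Notation B1 := (bundle1 E).
Local Notation B0 := (bundle0 E).
Local Notation rho1 := (trep1 rho).
Local Notation rho0 := (trep0 rho).

(* Structure maps of the associated groupoid, induced on classes: see asrcE, atgtE,
   aunitE and acompE. *)
Definition asrc (a : assoc B1 rho1) : assoc B0 rho0 :=
  acls B0 rho0 (gsrc E (repr a).1) (vsrc V (repr a).2).
Definition atgt (a : assoc B1 rho1) : assoc B0 rho0 :=
  acls B0 rho0 (gtgt E (repr a).1) (vtgt V (repr a).2).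
Definition aunit (a : assoc B0 rho0) : assoc B1 rho1 :=
  acls B1 rho1 (gunit E (repr a).1) (vunit V (repr a).2).
Definition acomp (a b : assoc B1 rho1) : assoc B1 rho1 :=
  xget a [set c | exists d d' z z',
    [/\ a = acls B1 rho1 d z, b = acls B1 rho1 d' z',
        gsrc E d = gtgt E d', vsrc V z = vtgt V z' &
        c = acls B1 rho1 (gcomp E d d') (vcomp V z z')]].

Lemma asrcE d z : asrc (acls B1 rho1 d z) = acls B0 rho0 (gsrc E d) (vsrc V z).
Proof.
rewrite /asrc; have /aclsP[g [-> ->]] := acls_repr (acls B1 rho1 d z).
apply/esym/aclsP; exists (gsrc G g).
by rewrite src_act trep_src (morphMV (src_mulg G)).
Qed.

Lemma atgtE d z : atgt (acls B1 rho1 d z) = acls B0 rho0 (gtgt E d) (vtgt V z).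
Proof.
rewrite /atgt; have /aclsP[g [-> ->]] := acls_repr (acls B1 rho1 d z).
apply/esym/aclsP; exists (gtgt G g).
by rewrite tgt_act trep_tgt (morphMV (tgt_mulg G)).
Qed.

Lemma aunitE p v : aunit (acls B0 rho0 p v) = acls B1 rho1 (gunit E p) (vunit V v).
Proof.
rewrite /aunit; have /aclsP[g [-> ->]] := acls_repr (acls B0 rho0 p v).
apply/esym/aclsP; exists (gunit G g).
by rewrite unit_act -(morphMV (unit_mulg G)) trep_unit.
Qed.

Lemma acompE d d' z z' : gsrc E d = gtgt E d' -> vsrc V z = vtgt V z' ->
  acomp (acls B1 rho1 d z) (acls B1 rho1 d' z') =
  acls B1 rho1 (gcomp E d d') (vcomp V z z').
Proof.
move=> dd' zz'; rewrite /acomp; case: xgetP => [c _|/(_ (acls B1 rho1 (gcomp E d d') (vcomp V z z')))].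
  move=> [e [e' [y [y' [/aclsP[g [-> ->]] /aclsP[h [-> ->]] + _ ->]]]]].
  rewrite src_act tgt_act -dd' => /pb_free gh.
  apply/esym/aclsP; exists (gcomp G g h); split; first by rewrite comp_act.
  rewrite -comp_invg // trep_comp //.
  by rewrite (morphMV (src_mulg G)) (morphMV (tgt_mulg G)) gh.
by case; exists d, d', z, z'.
Qed.

(* The fibre over x: classes over x and over gunit X x. *)
Section Fibre.
Variable x : obj X.
Local Notation F1 := (afib B1 rho1 (gunit X x)).
Local Notation F0 := (afib B0 rho0 x).

Fact proj_unit p : pb_proj B0 p = x -> pb_proj B1 (gunit E p) = gunit X x.
Proof. by move=> <-; exact: (functor_unit (proj_functor E)). Qed.

Fact fsrc_subproof (a : F1) : aproj (asrc (val a)) == x.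
Proof.
case: a => a /= /eqP; rewrite [a]acls_repr asrcE !aprojE => ax.
by rewrite -(functor_src (proj_functor E)) ax gsrc_unit.
Qed.
Fact ftgt_subproof (a : F1) : aproj (atgt (val a)) == x.
Proof.
case: a => a /= /eqP; rewrite [a]acls_repr atgtE !aprojE => ax.
by rewrite -(functor_tgt (proj_functor E)) ax gtgt_unit.
Qed.
Fact funit_subproof (a : F0) : aproj (aunit (val a)) == gunit X x.
Proof.
case: a => a /= /eqP; rewrite [a]acls_repr aunitE !aprojE => ax.
by rewrite proj_unit.
Qed.
Fact fcomp_subproof (a b : F1) : aproj (acomp (val a) (val b)) == gunit X x.
Proof.
case: a b => a ax [b bx] /=; rewrite /acomp; case: xgetP => // c _.
move=> [d [d' [z [z' [aE bE dd' _ ->]]]]]; rewrite aprojE.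
rewrite (functor_comp (proj_functor E) dd').
move: ax bx; rewrite aE bE !aprojE => /eqP -> /eqP ->.
by rewrite -{1}(gtgt_unit X x) gcomp1g.
Qed.

Definition fsrc (a : F1) : F0 := exist _ (asrc (val a)) (fsrc_subproof a).
Definition ftgt (a : F1) : F0 := exist _ (atgt (val a)) (ftgt_subproof a).
Definition funit (a : F0) : F1 := exist _ (aunit (val a)) (funit_subproof a).
Definition fcomp (a b : F1) : F1 := exist _ (acomp (val a) (val b)) (fcomp_subproof a b).

Section BasePoint.
Variables (p : objE E) (px : pb_proj B0 p = x).
Local Notation c0 v := (fcls (B := B0) rho0 v px).
Local Notation c1 z := (fcls (B := B1) rho1 z (proj_unit px)).

Lemma fsrcE z : fsrc (c1 z) = c0 (vsrc V z).
Proof. by apply: val_inj; rewrite /= asrcE gsrc_unit. Qed.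
Lemma ftgtE z : ftgt (c1 z) = c0 (vtgt V z).
Proof. by apply: val_inj; rewrite /= atgtE gtgt_unit. Qed.
Lemma funitE v : funit (c0 v) = c1 (vunit V v).
Proof. by apply: val_inj; rewrite /= aunitE. Qed.
Lemma fcompE z z' : vsrc V z = vtgt V z' -> fcomp (c1 z) (c1 z') = c1 (vcomp V z z').
Proof.
move=> zz'; apply: val_inj; rewrite /= acompE ?gsrc_unit ?gtgt_unit //.
by rewrite -{1}(gtgt_unit E p) gcomp1g.
Qed.

End BasePoint.

Let px := fbaseP B0 x.
Local Notation c0 v := (fcls (B := B0) rho0 v px).
Local Notation c1 z := (fcls (B := B1) rho1 z (proj_unit px)).
Let surj0 (a : F0) : exists v, a = c0 v := fcls_surj px a.
Let surj1 (a : F1) : exists z, a = c1 z := fcls_surj (proj_unit px) a.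

Fact fsrc_linear : linear fsrc.
Proof.
move=> k a b; have [z ->] := surj1 a; have [w ->] := surj1 b.
by rewrite -fcls_linear !fsrcE linearP fcls_linear.
Qed.
HB.instance Definition _ := GRing.isLinear.Build R F1 F0 _ fsrc fsrc_linear.

Fact ftgt_linear : linear ftgt.
Proof.
move=> k a b; have [z ->] := surj1 a; have [w ->] := surj1 b.
by rewrite -fcls_linear !ftgtE linearP fcls_linear.
Qed.
HB.instance Definition _ := GRing.isLinear.Build R F1 F0 _ ftgt ftgt_linear.

Fact funit_linear : linear funit.
Proof.
move=> k a b; have [z ->] := surj0 a; have [w ->] := surj0 b.
by rewrite -fcls_linear !funitE linearP fcls_linear.
Qed.
HB.instance Definition _ := GRing.isLinear.Build R F0 F1 _ funit funit_linear.

Fact fsrc_unit a : fsrc (funit a) = a.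
Proof. by have [z ->] := surj0 a; rewrite funitE fsrcE vsrc_unit. Qed.
Fact ftgt_unit a : ftgt (funit a) = a.
Proof. by have [z ->] := surj0 a; rewrite funitE ftgtE vtgt_unit. Qed.

Lemma fcomposable z w : fsrc (c1 z) = ftgt (c1 w) -> vsrc V z = vtgt V w.
Proof. by rewrite fsrcE ftgtE => /fclsP. Qed.

Fact fsrc_comp a b : fsrc a = ftgt b -> fsrc (fcomp a b) = fsrc b.
Proof.
have [z ->] := surj1 a; have [w ->] := surj1 b => /fcomposable zw.
by rewrite fcompE // !fsrcE vsrc_comp.
Qed.
Fact ftgt_comp a b : fsrc a = ftgt b -> ftgt (fcomp a b) = ftgt a.
Proof.
have [z ->] := surj1 a; have [w ->] := surj1 b => /fcomposable zw.
by rewrite fcompE // !ftgtE vtgt_comp.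
Qed.
Fact fcompA a b c : fsrc a = ftgt b -> fsrc b = ftgt c ->
  fcomp a (fcomp b c) = fcomp (fcomp a b) c.
Proof.
have [z ->] := surj1 a; have [w ->] := surj1 b; have [y ->] := surj1 c.
move=> /fcomposable zw /fcomposable wy.
by rewrite !fcompE ?vcompA ?vtgt_comp ?vsrc_comp.
Qed.
Fact fcomp1v a : fcomp (funit (ftgt a)) a = a.
Proof.
have [z ->] := surj1 a.
by rewrite ftgtE funitE fcompE ?vsrc_unit // vcomp1v.
Qed.
Fact fcompv1 a : fcomp a (funit (fsrc a)) = a.
Proof.
have [z ->] := surj1 a.
by rewrite fsrcE funitE fcompE ?vtgt_unit // vcompv1.
Qed.
Fact fcomp_linear (k : R) a b a' b' : fsrc a = ftgt b -> fsrc a' = ftgt b' ->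
  fcomp (k *: a + a') (k *: b + b') = k *: fcomp a b + fcomp a' b'.
Proof.
have [z ->] := surj1 a; have [w ->] := surj1 b.
have [z' ->] := surj1 a'; have [w' ->] := surj1 b'.
move=> /fcomposable zw /fcomposable zw'.
rewrite -!fcls_linear !fcompE //; last by rewrite !linearP zw zw'.
by rewrite vcomp_linear // fcls_linear.
Qed.

Definition fibre : two_vect R :=
  @TwoVect R F1 F0 fsrc ftgt funit fcomp fsrc_unit ftgt_unit fsrc_comp ftgt_comp
    fcompA fcomp1v fcompv1 fcomp_linear.

End Fibre.
End AssociatedGroupoid.

(* Main.v *)
Require Import Defs.
From HB Require Import structures.
From mathcomp Require Import all_boot all_order all_algebra.
From mathcomp Require Import lra.
From mathcomp Require Import all_classical all_reals topology normedtype landau derive.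
From mathcomp Require Import measure lebesgue_measure lebesgue_integral ftc.

Set Implicit Arguments.
Unset Strict Implicit.
Unset Printing Implicit Defensive.

Import Order.TTheory GRing.Theory Num.Theory.
Import numFieldNormedType.Exports.

Local Open Scope classical_set_scope.
Local Open Scope ring_scope.

(** Parallel transport in E_0 along alpha commutes with the action of G_0, so
    [p, v] |-> [Tr p, v] is well defined on the fibre of the associated bundle over x.
    In the frames p and Tr p both fibres are copies of V_0 and the map is the identity
    of V_0: hence it is linear, and exchanging the two frames inverts it.  The same
    holds for E_1 over the path of units u o alpha.  The two maps form a functor
    because the connection is one: the unit map of E sends horizontal curves to
    horizontal curves (unit_horizontal_lift), whence Tr(1_p) = 1_(Tr p)
    (transport_unit).  Every class over 1_x has a representative in the frame 1_p, and
    in the frames 1_p and 1_(Tr p) the structure maps of both fibres are those of V.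

    The substance is thus that horizontal lifts exist, are unique, and are permuted
    by the structure group.  If c and c.g lie over the same curve, the connection form
    takes on (c.g)' the value Ad(g^-1) om(c') + g^-1 g' (connection_product).

    - Two horizontal lifts of one curve are related by a curve g with g^-1 g' = 0,
      which is constant (horizontal_rigidity).  This gives uniqueness and
      equivariance at once.
    - Locally a lift has the form s.g, where s is the image of the curve under a
      section and g solves the right-invariant equation g' = - om(s') g (local_lift).
      In the chart of the group at the unit this is an equation
      x' = sum_i A_i(t) b_i(x) with smooth A_i and b_i (group_ode), which Picard
      iteration solves (control_ode) and whose solutions are smooth
      (control_ode_smooth).
    - The group moves a local lift to any starting point in the fibre, so the
      neighbourhood on which it exists depends on the time only; finitely many of
      them cover the unit interval, and rigidity makes the pieces agree on overlaps
      (liftable_segment).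

    Smoothness is expressed by iterated directional derivatives.  That such functions
    are Frechet differentiable (C1_differentiable) and closed under composition
    (Ck_on_comp) yields the chain rule for differentials of maps between manifolds
    (tdiff_comp), on which all computations above rest. *)

(** * Functions with continuous iterated directional derivatives *)

Section CkCalculus.
Variables (R : realType) (n : nat).
Implicit Types (U : set 'rV[R]_n) (f g : 'rV[R]_n -> R).

Lemma Ck_on_continuous k U f : Ck_on k U f -> forall x, U x -> {for x, continuous f}.
Proof. by case: k => [|k] []. Qed.

Lemma Ck_on_derivable k U f : Ck_on k.+1 U f ->
  forall x, U x -> forall v, derivable f x v.
Proof. by case=> _ df x Ux v; have [+ _] := df v; exact. Qed.
(* derivable unfolds to a product, so that v would otherwise become implicit. *)
Arguments Ck_on_derivable : clear implicits.
Arguments Ck_on_derivable {k U f}.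

Lemma Ck_on_derive k U f v : Ck_on k.+1 U f -> Ck_on k U (fun x => 'D_v f x).
Proof. by case=> _ /(_ v)[]. Qed.

Lemma Ck_onW k U f : Ck_on k.+1 U f -> Ck_on k U f.
Proof.
elim: k f => [|k IH] f; first by case.
by case=> fc df; split=> // v; have [d1 d2] := df v; split=> //; exact: IH.
Qed.

Lemma Ck_on_C1 k U f : Ck_on k.+1 U f -> Ck_on 1 U f.
Proof. by elim: k => // k IH /Ck_onW. Qed.

Lemma Ck_on_ext k U f g : open U -> (forall x, U x -> f x = g x) ->
  Ck_on k U f -> Ck_on k U g.
Proof.
move=> oU; have near_eq (f' g' : 'rV[R]_n -> R) : (forall x, U x -> f' x = g' x) ->
    forall x, U x -> {near x, f' =1 g'}.
  by move=> fg x Ux; apply: filterS (open_nbhs_nbhs (conj oU Ux)) => y /fg.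
have cont (f' g' : 'rV[R]_n -> R) : (forall x, U x -> f' x = g' x) ->
    (forall x, U x -> {for x, continuous f'}) ->
    forall x, U x -> {for x, continuous g'}.
  move=> fg fc x Ux; rewrite /prop_for /continuous_at -(fg _ Ux).
  exact: cvg_trans (near_eq_cvg (F := nbhs x) (near_eq _ _ fg x Ux)) (fc _ Ux).
elim: k f g => [|k IH] f g fg /= [fc df]; split=> //; do ?exact: cont fc.
move=> v; have [d1 d2] := df v; split=> [x Ux|].
  exact: near_eq_derivable (near_eq _ _ fg x Ux) (d1 x Ux).
by apply: IH d2 => x Ux; apply: near_eq_derive; exact: (near_eq _ _ fg x Ux).
Qed.

Lemma Ck_onD k U f g : open U ->
  Ck_on k U f -> Ck_on k U g -> Ck_on k U (fun x => f x + g x).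
Proof.
move=> oU; elim: k f g => [|k IH] f g /= [fc df] [gc dg]; split=> //;
  do ?by move=> x Ux; apply: continuousD; [exact: fc|exact: gc].
move=> v; have [f1 f2] := df v; have [g1 g2] := dg v; split=> [x Ux|].
  by apply: derivableD; [exact: f1|exact: g1].
apply: Ck_on_ext oU _ (IH _ _ f2 g2) => x Ux.
by rewrite -(deriveD (f1 _ Ux) (g1 _ Ux)).
Qed.

Lemma Ck_onM k U f g : open U ->
  Ck_on k U f -> Ck_on k U g -> Ck_on k U (fun x => f x * g x).
Proof.
move=> oU; elim: k f g => [|k IH] f g fU gU.
  split=> // x Ux.
  by apply: continuousM; [exact: Ck_on_continuous fU _ Ux|exact: Ck_on_continuous gU _ Ux].
split=> [x Ux|v].
  by apply: continuousM; [exact: Ck_on_continuous fU _ Ux|exact: Ck_on_continuous gU _ Ux].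
split=> [x Ux|].
  by apply: derivableM; [exact: Ck_on_derivable fU x Ux v|exact: Ck_on_derivable gU x Ux v].
have h := Ck_onD oU (IH _ _ (Ck_onW fU) (Ck_on_derive v gU))
  (IH _ _ (Ck_onW gU) (Ck_on_derive v fU)).
apply: Ck_on_ext oU _ h => x Ux.
by rewrite -(deriveM (Ck_on_derivable fU x Ux v) (Ck_on_derivable gU x Ux v)).
Qed.

Lemma Ck_on_sum k U m (f : 'I_m -> 'rV[R]_n -> R) : open U ->
  (forall i, Ck_on k U (f i)) -> Ck_on k U (fun x => \sum_(i < m) f i x).
Proof.
move=> oU; elim: m f => [|m IH] f fU.
  have -> : (fun x => \sum_(i < 0) f i x) = (fun=> 0).
    by apply/funext => x; rewrite big_ord0.
  exact: Ck_on_cst.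
have -> : (fun x => \sum_(i < m.+1) f i x) =
    (fun x => \sum_(i < m) f (widen_ord (leqnSn m) i) x + f ord_max x).
  by apply/funext => x; rewrite big_ord_recr.
by apply: Ck_onD => //; exact: IH.
Qed.

Lemma mean_value (phi dphi : R -> R) (a b : R) :
  (forall s : R, `|s - a| <= `|b - a| -> is_derive s (1 : R) phi (dphi s)) ->
  exists2 c, `|c - a| <= `|b - a| & phi b - phi a = (b - a) * dphi c.
Proof.
move=> dp.
have cp s : `|s - a| <= `|b - a| -> {for s, continuous phi}.
  by move=> sa; apply/differentiable_continuous/derivable1_diffP; have [] := dp _ sa.
have [ab|ba] := leP a b.
  have le s : s \in `[a, b] -> `|s - a| <= `|b - a|.
    by rewrite in_itv /= => /andP[? ?]; rewrite !ger0_norm ?subr_ge0 // lerD2r.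
  have [s /subset_itv_oo_cc/le /dp //||c ca ->] := @MVT_segment R phi dphi a b ab.
    by apply: continuous_in_subspaceT => s; rewrite inE /= => /le /cp.
  by exists c; [exact: le|rewrite mulrC].
have le s : s \in `[b, a] -> `|s - a| <= `|b - a|.
  rewrite in_itv /= => /andP[? ?].
  by rewrite !ler0_norm ?subr_le0 // ?lerN2 ?lerD2r // ltW.
have [s /subset_itv_oo_cc/le /dp //||c ca E] := @MVT_segment R phi dphi b a (ltW ba).
  by apply: continuous_in_subspaceT => s; rewrite inE /= => /le /cp.
exists c; first exact: le.
by rewrite -opprB E -mulrN opprB mulrC.
Qed.

Lemma derive_line (W : normedModType R) (f : 'rV[R]_n -> W) x v (s : R) :
  derivable f (s *: v + x) v ->
  is_derive s 1 (fun s => f (s *: v + x)) ('D_v f (s *: v + x)).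
Proof.
move=> fx.
have E : (fun h : R => h^-1 *:
      (((fun s => f (s *: v + x)) \o shift s) (h *: (1 : R)) - f (s *: v + x)))
   = (fun h : R => h^-1 *: ((f \o shift (s *: v + x)) (h *: v) - f (s *: v + x))).
  apply/funext => h /=; congr (_ *: (f _ - _)).
  by rewrite [h *: 1]mulr1 scalerDl addrA.
by split; rewrite /derivable /derive E.
Qed.

Lemma mean_value_dir f x v (a : R) :
  (forall s, `|s| <= `|a| -> derivable f (s *: v + x) v) ->
  exists2 c, `|c| <= `|a| & f (a *: v + x) - f x = a * 'D_v f (c *: v + x).
Proof.
move=> fx; have [s|c] := @mean_value (fun s => f (s *: v + x))
  (fun s => 'D_v f (s *: v + x)) 0 a.
  by rewrite !subr0 => sa; apply: derive_line; exact: fx.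
by rewrite !subr0 => ca; rewrite scale0r add0r => E; exists c.
Qed.

Lemma is_diff_expansion (W : normedModType R) (V : normedModType R) (f : V -> W)
    (L : {linear V -> W}) x : continuous L ->
  (forall e, 0 < e -> \forall h \near (0 : V), `|f (h + x) - (f x + L h)| <= e * `|h|) ->
  is_diff x f L.
Proof.
move=> Lc fL.
have E : f \o shift x = cst (f x) + L +o_ (0 : V) id.
  by apply/eqaddoP => e e0; exact: fL.
have dE := diff_unique Lc E.
by split=> //; apply/diff_locallyP; split; rewrite dE.
Qed.

End CkCalculus.

Section CkChainRule.
Variable R : realType.

Lemma rV_norm_le n (v : 'rV[R]_n) (r : R) :
  0 <= r -> (forall j, `|v 0 j| <= r) -> `|v| <= r.
Proof.
move=> r0 vr; rewrite /Num.Def.normr /= mx_normrE.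
by apply: bigmax_le => // -[i j] _ /=; rewrite (ord1 i).
Qed.

Lemma rV_norm_coord n (v : 'rV[R]_n) j : `|v 0 j| <= `|v|.
Proof.
rewrite [leRHS]/Num.Def.normr /= mx_normrE.
exact: (le_bigmax _ (fun ij => `|v ij.1 ij.2|) (0, j)).
Qed.

Lemma differentiable_rV n (V : normedModType R) (f : V -> 'rV[R]_n) x :
  (forall j, differentiable (fun y => f y 0 j) x) -> differentiable f x.
Proof.
move=> df; have -> : f = \sum_(j < n) (fun y => f y 0 j *: (delta_mx 0 j : 'rV[R]_n)).
  by apply/funext => y; rewrite fct_sumE -row_sum_delta.
by apply: differentiable_sum => j; exact: differentiableZl.
Qed.

(** Moving from x to h + x one coordinate at a time, the mean value theorem on
    each leg compares the increment of f with a partial derivative at a nearby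
    point, hence by continuity with that partial derivative at x. *)
Lemma C1_differentiable n (U : set 'rV[R]_n) (f : 'rV[R]_n -> R) x :
  open U -> Ck_on 1 U f -> U x -> differentiable f x.
Proof.
move=> oU fU Ux.
pose e_ (j : 'I_n) : 'rV[R]_n := delta_mx 0 j.
pose L (h : 'rV[R]_n) : R := \sum_j 'D_(e_ j) f x * h 0 j.
have linL : linear L.
  move=> a h k; rewrite scaler_sumr -big_split /=; apply: eq_bigr => j _.
  by rewrite !mxE mulrDr mulrCA.
pose LM := GRing.isLinear.Build R 'rV[R]_n R^o _ L linL.
pose LL : {linear 'rV[R]_n -> R^o} := HB.pack L LM.
have cL : continuous LL.
  move=> y; apply: differentiable_continuous.
  have -> : (LL : _ -> _) = \sum_(j < n) (fun h : 'rV[R]_n => 'D_(e_ j) f x *: (h 0 j : R^o)).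
    by apply/funext => h; rewrite fct_sumE.
  apply: differentiable_sum => j; apply: differentiableZ; exact: differentiable_coord.
suff H : forall e, 0 < e ->
    \forall h \near (0 : 'rV[R]_n), `|f (h + x) - (f x + LL h)| <= e * `|h|.
  by have [] := is_diff_expansion cL H.
move=> e e0.
(* The errors of the n legs add up; n.+1 also serves n = 0. *)
have en : 0 < e / n.+1%:R by rewrite divr_gt0.
have : \forall y \near x, U y /\ forall j, `|'D_(e_ j) f x - 'D_(e_ j) f y| <= e / n.+1%:R.
  have nU : nbhs x U by exact: open_nbhs_nbhs.
  have nd : \forall y \near x, forall j, `|'D_(e_ j) f x - 'D_(e_ j) f y| <= e / n.+1%:R.
    apply: (@filter_forall _ _ _ (nbhs x)) => j.
    have /cvgrPdist_le := Ck_on_continuous (Ck_on_derive (e_ j) fU) Ux.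
    exact.
  by apply: filterS2 nU nd => y; split.
move=> /nbhs_ballP[r /= r0 rU].
apply/nbhs_ballP; exists r => //= h; rewrite -ball_normE /= sub0r normrN => hr.
(* The corners of the path from 0 to h: p k has the first k coordinates of h. *)
pose p (k : nat) : 'rV[R]_n := \row_j (if (j < k)%N then h 0 j else 0).
have pS (k : 'I_n) : p k.+1 = h 0 k *: e_ k + p k.
  apply/rowP => j; rewrite !mxE /= ltnS leq_eqVlt -(inj_eq val_inj) /=.
  by case: eqVneq => [/val_inj ->|_]; rewrite /= ?ltnn ?mulr1 ?addr0 // mulr0 add0r.
have pn : p n = h by apply/rowP => j; rewrite mxE ltn_ord.
have p0 : p 0%N = 0 by apply/rowP => j; rewrite !mxE.
have leg (k : 'I_n) : `|f (p k.+1 + x) - f (p k + x) - 'D_(e_ k) f x * h 0 k| <=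
    e / n.+1%:R * `|h|.
  have near_x s : `|s| <= `|h 0 k| -> ball x r (s *: e_ k + (p k + x)).
    move=> sh; rewrite -ball_normE /= addrA opprD addrCA subrr addr0 normrN.
    apply: le_lt_trans hr; apply: rV_norm_le => // j; rewrite !mxE /=.
    case: eqVneq => [->|_] /=; rewrite ?ltnn ?mulr1 ?addr0 ?mulr0 ?add0r.
      by apply: (le_trans sh); exact: rV_norm_coord.
    by case: ifP; rewrite ?normr0 // rV_norm_coord.
  have [s /near_x/rU[Us _]|c ch] := @mean_value_dir _ _ f (p k + x) (e_ k) (h 0 k).
    exact: Ck_on_derivable fU _ Us (e_ k).
  rewrite addrA -pS => ->; rewrite mulrC -mulrBl normrM.
  apply: ler_pM => //; last exact: rV_norm_coord.
  by rewrite distrC; exact: (rU _ (near_x c ch)).2.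
have -> : f (h + x) - (f x + LL h) =
    \sum_(k < n) (f (p k.+1 + x) - f (p k + x) - 'D_(e_ k) f x * h 0 k).
  rewrite sumrB -(big_mkord xpredT (fun k => f (p k.+1 + x) - f (p k + x))).
  by rewrite telescope_sumr // pn p0 add0r opprD addrA.
apply: le_trans (ler_norm_sum _ _ _) _.
apply: le_trans (ler_sum _ (fun k _ => leg k)) _.
rewrite sumr_const card_ord -mulrnAl -mulr_natr ler_wpM2r //.
by rewrite mulrAC ler_pdivrMr // ler_wpM2l ?ler_nat // ltW.
Qed.

Lemma C1_differentiable_rV n m (W : set 'rV[R]_n) (g : 'rV[R]_n -> 'rV[R]_m) x :
  open W -> (forall j, Ck_on 1 W (fun y => g y 0 j)) -> W x -> differentiable g x.
Proof. by move=> oW gW Wx; apply: differentiable_rV => j; exact: C1_differentiable Wx. Qed.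

Lemma derive_comp_rV n m (f : 'rV[R]_m -> R) (g : 'rV[R]_n -> 'rV[R]_m) x v :
  differentiable g x -> differentiable f (g x) ->
  'D_v (fun y => f (g y)) x =
  \sum_(j < m) 'D_(delta_mx 0 j) f (g x) * 'D_v (fun y => g y 0 j) x.
Proof.
move=> dg df; rewrite deriveE; last exact: differentiable_comp.
rewrite (diff_comp dg df) /= -(deriveE v dg).
have -> : 'D_v g x = \row_j 'D_v (fun y => g y 0 j) x.
  rewrite derive_mx; last exact: diff_derivable.
  by apply/rowP => j; rewrite !mxE.
rewrite [X in 'd f _ X]row_sum_delta linear_sum; apply: eq_bigr => j _.
by rewrite linearZ /= mxE (deriveE (delta_mx 0 j) df) [RHS]mulrC.
Qed.

(** By the chain rule, a directional derivative of the composite is a sum of products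
    of functions of class C^k, one factor being again a composite. *)
Lemma Ck_on_comp k n m (U : set 'rV[R]_m) (W : set 'rV[R]_n) f
    (g : 'rV[R]_n -> 'rV[R]_m) : open U -> open W ->
  (forall x, W x -> U (g x)) -> (forall j, Ck_on k W (fun x => g x 0 j)) ->
  Ck_on k U f -> Ck_on k W (fun x => f (g x)).
Proof.
move=> oU oW WU; elim: k f => [|k IH] f gW fU.
  split=> // x Wx; apply: (@continuous_comp _ _ _ g f).
    apply: (cvg_mxP (F := nbhs x)) => i j; rewrite (ord1 i).
    exact: Ck_on_continuous (gW j) _ Wx.
  exact: Ck_on_continuous fU _ (WU _ Wx).
have dg x : W x -> differentiable g x.
  by move=> Wx; apply: C1_differentiable_rV Wx => // j; exact: Ck_on_C1 (gW j).
have df x : W x -> differentiable f (g x).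
  by move=> Wx; apply: C1_differentiable (WU _ Wx) => //; exact: Ck_on_C1 fU.
have dfg x : W x -> differentiable (fun y => f (g y)) x.
  by move=> Wx; apply: differentiable_comp; [exact: dg|exact: df].
split=> [x Wx|v]; first exact: differentiable_continuous (dfg _ Wx).
split=> [x Wx|]; first exact: diff_derivable (dfg _ Wx).
have h : Ck_on k W (fun x => \sum_(j < m) 'D_(delta_mx 0 j) f (g x) *
    'D_v (fun y => g y 0 j) x).
  apply: Ck_on_sum => // j; apply: Ck_onM => //.
    by apply: (IH (fun y => 'D_(delta_mx 0 j) f y)) => [i|];
      [exact: Ck_onW|exact: Ck_on_derive].
  exact: Ck_on_derive (gW j).
by apply: Ck_on_ext oW _ h => x Wx; rewrite derive_comp_rV //; [exact: dg|exact: df].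
Qed.

End CkChainRule.

(** * Ordinary differential equations *)

Section Picard.
Variable R : realType.

Lemma exists_primitive (f : R -> R) (a b : R) : continuous f -> a < b ->
  exists F : R -> R, forall t : R, a < t < b -> is_derive t (1 : R) F (f t).
Proof.
move=> fc ab; have fint : lebesgue_measure.-integrable `[a, b] (EFin \o f).
  apply: continuous_compact_integrable; first exact: segment_compact.
  exact: continuous_subspaceT.
exists (fun t => \int[lebesgue_measure]_(s in `[a, t]) f s)%R => t /andP[at_ tb].
have [dF <-] := continuous_FTC1_closed tb fint at_ (fc t).
by rewrite derive1E; exact: derivableP.
Qed.

(** The sequence u k - r k increases, u k + r k decreases, where r k bounds the tail of
    the geometric series from k on; the supremum of the former is the limit. *)
Lemma geometric_limit (u : nat -> R) (M : R) :
  (forall k, `|u k.+1 - u k| <= M / 2 ^+ k) ->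
  exists l, forall k, `|l - u k| <= 2 * M / 2 ^+ k.
Proof.
move=> uM; pose r k := 2 * M / 2 ^+ k.
have M0 : 0 <= M by rewrite -[M]divr1 -[1](expr0 (2 : R)); apply: le_trans (uM 0%N).
have r0 k : 0 <= r k by rewrite /r; apply: divr_ge0; [apply: mulr_ge0|apply: exprn_ge0].
have rS k : r k.+1 = M / 2 ^+ k by rewrite /r exprS invfM mulrACA divff ?mul1r ?pnatr_eq0.
have rE k : r k = r k.+1 + r k.+1 by rewrite rS /r -mulrA mulr2n mulrDl mul1r.
have lo k m : u k - r k <= u (k + m)%N - r (k + m)%N.
  elim: m => [|m IH]; first by rewrite addn0.
  apply: le_trans IH _; rewrite addnS; have := uM (k + m)%N.
  by rewrite -rS (rE (k + m)%N) ler_norml => /andP[+ _]; lra.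
have hi k m : u (k + m)%N + r (k + m)%N <= u k + r k.
  elim: m => [|m IH]; first by rewrite addn0.
  apply: le_trans _ IH; rewrite addnS; have := uM (k + m)%N.
  by rewrite -rS (rE (k + m)%N) ler_norml => /andP[_ +]; lra.
have lohi k m : u k - r k <= u m + r m.
  have := lo k m; have := hi m k; rewrite addnC; have := r0 (k + m)%N; lra.
pose A := [set u k - r k | k in [set: nat]].
have A0 : A !=set0 by exists (u 0%N - r 0%N); exists 0%N.
exists (sup A) => k; rewrite ler_norml -/(r k).
have le1 : u k - r k <= sup A.
  apply: ub_le_sup; last by exists k.
  by exists (u 0%N + r 0%N) => _ [m _ <-].
have le2 : sup A <= u k + r k by apply: ge_sup => // _ [m _ <-].
by apply/andP; split; lra.
Qed.

Lemma half_pow_small (M e : R) : 0 <= M -> 0 < e -> exists k, M / 2 ^+ k < e.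
Proof.
move=> M0 e0; exists (Num.bound (M / e)).
rewrite ltr_pdivrMr ?exprn_gt0 // mulrC -ltr_pdivrMr //.
apply: lt_trans (archi_boundP _) _; first by rewrite divr_ge0 // ltW.
by rewrite -natrX ltr_nat ltn_expl.
Qed.

Definition clamp (a b t : R) : R := Num.max a (Num.min b t).

Lemma clamp_continuous a b : continuous (clamp a b).
Proof.
by move=> t; apply: continuous_max; [exact: cst_continuous|
  apply: continuous_min; [exact: cst_continuous|exact: cvg_id]].
Qed.

Lemma clamp_bound a b t : a <= b -> a <= clamp a b t <= b.
Proof. by move=> ab; rewrite /clamp le_max lexx ge_max ab ge_min lexx. Qed.

Lemma clamp_id a b t : a <= t <= b -> clamp a b t = t.
Proof. by move=> /andP[at_ tb]; rewrite /clamp (min_idPr tb) (max_idPr at_). Qed.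

Lemma clamp_lipschitz a b s t : a <= b -> `|clamp a b s - clamp a b t| <= `|s - t|.
Proof.
wlog st : s t / s <= t => [H ab|ab].
  have [/H|/ltW/H] := leP s t; first exact.
  by rewrite distrC (distrC t); exact.
rewrite distrC (distrC s) (ger0_norm (_ : 0 <= t - s)) ?subr_ge0 //.
have mono : clamp a b s <= clamp a b t.
  by rewrite /clamp le_max2 // le_min2.
rewrite ger0_norm ?subr_ge0 // /clamp.
rewrite /Order.max /Order.min.
by have [bs|bs] := ltP b s; have [bt|bt] := ltP b t;
  repeat (case: ltP => ?); lra.
Qed.

End Picard.

Section PicardLindelof.
Variable R : realType.

Lemma rV_continuous n (T : topologicalType) (f : T -> 'rV[R]_n) (x : T) :
  (forall j, {for x, continuous (fun y => f y 0 j)}) -> {for x, continuous f}.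
Proof.
by move=> fc; apply: (cvg_mxP (F := nbhs x)) => i j; rewrite (ord1 i); exact: fc.
Qed.

Lemma is_derive_continuous (f : R -> R) (t df : R) :
  is_derive t (1 : R) f df -> {for t, continuous f}.
Proof. by case=> /derivable1_diffP df1 _; exact: differentiable_continuous. Qed.

Lemma continuous_lipschitz_comp n m (F : R -> 'rV[R]_n -> 'rV[R]_m) (K : R)
    (y : R -> 'rV[R]_n) : 0 <= K ->
  (forall x, continuous (fun t => F t x)) ->
  (forall t x x', `|F t x - F t x'| <= K * `|x - x'|) ->
  continuous y -> continuous (fun t => F t (y t)).
Proof.
move=> K0 Fc FK yc t; apply/cvgrPdist_le => e e0.
have e1 : 0 < e / 2 by rewrite divr_gt0.
have e2 : 0 < e / 2 / (K + 1) by rewrite divr_gt0 // ltr_wpDl.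
have /cvgrPdist_le/(_ _ e1) n1 := Fc (y t) t.
have /cvgrPdist_le/(_ _ e2) n2 := yc t.
apply: filterS2 n1 n2 => s h1 h2.
rewrite -(subrKA (F s (y t))); apply: le_trans (ler_normD _ _) _.
rewrite (splitr e) lerD // (le_trans (FK _ _ _)) //.
apply: (@le_trans _ _ ((K + 1) * `|y t - y s|)).
  by rewrite ler_wpM2r // lerDl.
by rewrite mulrC -ler_pdivlMr // ltr_wpDl.
Qed.

(** Picard iteration.  The iterates are precomposed with the projection of the line
    onto [t0 - e, t0 + e], so that they are defined and continuous everywhere and all
    estimates are uniform in t. *)
Lemma picard_lipschitz n (F : R -> 'rV[R]_n -> 'rV[R]_n) (K t0 : R) x0 : 0 <= K ->
  (forall x, continuous (fun t => F t x)) ->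
  (forall t x x', `|F t x - F t x'| <= K * `|x - x'|) ->
  exists (e : R) (x : R -> 'rV[R]_n), [/\ 0 < e, x t0 = x0 &
    forall t, `|t - t0| < e ->
      forall j, is_derive t (1 : R) (fun s => x s 0 j) (F t (x t) 0 j)].
Proof.
move=> K0 Fc FK.
have Fy := continuous_lipschitz_comp K0 Fc FK.
have [d d0 dF] : exists2 d : R, 0 < d &
    forall t, `|t - t0| <= d -> `|F t x0| <= `|F t0 x0| + 1.
  have /cvgrPdist_le/(_ _ ltr01)/nbhs_ballP[d /= d0 dF] := Fc x0 t0.
  exists (d / 2); first by rewrite divr_gt0.
  move=> t td; have /dF : ball t0 d t.
    rewrite -ball_normE /= distrC (le_lt_trans td) // gtr_pMr // invf_lt1 ?ltr1n //.
  move=> h; rewrite -(subrK (F t0 x0) (F t x0)) (le_trans (ler_normD _ _)) //.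
  by rewrite distrC addrC lerD2l.
(* The first bound controls the first step of the iteration; the second makes the
   iteration a contraction of ratio 1/2. *)
pose e : R := Num.min d (2 * (K + 1))^-1.
have K1 : 0 < 2 * (K + 1) by rewrite mulr_gt0 // ltr_wpDl.
have e0 : 0 < e by rewrite lt_min d0 invr_gt0.
have eK : e * K <= 2^-1.
  have : e * (2 * (K + 1)) <= 1 by rewrite -ler_pdivlMr // div1r ge_min lexx orbT.
  have : 0 <= e by exact: ltW.
  lra.
have P_ex (y : R -> 'rV[R]_n) : exists p : R -> 'rV[R]_n, continuous y -> p t0 = 0 /\
    forall t, `|t - t0| < 2 * e ->
      forall j, is_derive t (1 : R) (fun s => p s 0 j) (F t (y t) 0 j).
  have [yc|] := pselect (continuous y); last by exists (fun=> 0).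
  have /choice[p pP] (j : 'I_n) : exists p : R -> R, forall t : R,
      t0 - 2 * e < t < t0 + 2 * e -> is_derive t (1 : R) p (F t (y t) 0 j).
    apply: exists_primitive; last by lra.
    move=> t; apply: (@continuous_comp _ _ _ (fun t => F t (y t)) (fun v : 'rV[R]_n => v 0 j)).
      exact: Fy.
    exact: coord_continuous.
  exists (fun t => \row_j (p j t - p j t0)) => _; split=> [|t tt j].
    by apply/rowP => j; rewrite !mxE subrr.
  have -> : (fun s => (\row_j (p j s - p j t0)) 0 j) = p j - cst (p j t0).
    by apply/funext => s; rewrite mxE.
  rewrite -[X in is_derive _ _ _ X]subr0; apply: is_deriveB; apply: pP.
  by move: tt; rewrite ltr_norml; lra.
have [P {P_ex}PP] := choice P_ex.
pose c := clamp (t0 - e) (t0 + e).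
have ce t : `|c t - t0| <= e.
  have : t0 - e <= c t <= t0 + e by apply: clamp_bound; lra.
  by rewrite ler_norml; lra.
pose Phi y := (fun t => x0 + P y (c t)) : R -> 'rV[R]_n.
have Phi_cont y : continuous y -> continuous (Phi y).
  move=> yc t; apply: continuousD; first exact: cst_continuous.
  apply: (@continuous_comp _ _ _ c (P y)); first exact: clamp_continuous.
  apply: rV_continuous => j; apply: is_derive_continuous; apply: (PP y yc).2.
  by apply: le_lt_trans (ce t) _; lra.
have incr (p f : R -> 'rV[R]_n) D : p t0 = 0 ->
    (forall t, `|t - t0| <= e ->
      forall j, is_derive t (1 : R) (fun s => p s 0 j) (f t 0 j)) ->
    (forall t, `|t - t0| <= e -> `|f t| <= D) -> forall t, `|p (c t)| <= e * D.
  move=> p0 dp fD t.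
  have D0 : 0 <= D by apply: le_trans (fD t0 _); rewrite ?subrr ?normr0 // ltW.
  apply: rV_norm_le => [|j]; first by rewrite mulr_ge0 // ltW.
  have [s sa|s sa] := @mean_value R (fun s => p s 0 j) (fun s => f s 0 j) t0 (c t).
    by apply: dp; exact: le_trans sa (ce t).
  rewrite p0 mxE subr0 => ->; rewrite normrM ler_pM //.
  by apply: le_trans (rV_norm_coord _ _) (fD _ _); exact: le_trans sa (ce t).
have e2e t : `|t - t0| <= e -> `|t - t0| < 2 * e by move=> h; apply: le_lt_trans h _; lra.
have contr y z D : continuous y -> continuous z -> (forall t, `|y t - z t| <= D) ->
    forall t, `|Phi y t - Phi z t| <= D / 2.
  move=> yc zc yz t; have [y0 dy] := PP y yc; have [z0 dz] := PP z zc.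
  have D0 : 0 <= D by exact: le_trans (yz t).
  rewrite /Phi opprD addrACA subrr add0r.
  apply: (@le_trans _ _ (e * (K * D))); last first.
    by rewrite mulrA mulrC ler_wpM2l.
  apply: (incr (fun t => P y t - P z t) (fun t => F t (y t) - F t (z t))).
  - by rewrite y0 z0 subrr.
  - move=> s se j; rewrite !mxE.
    have -> : (fun s => (P y s - P z s) 0 j) = (fun s => P y s 0 j) - (fun s => P z s 0 j).
      by apply/funext => u; rewrite !mxE.
    by apply: is_deriveB; [apply: dy|apply: dz]; exact: e2e.
  - by move=> s _; apply: le_trans (FK _ _ _) _; rewrite ler_wpM2l.
pose y k := iter k Phi (fun=> x0).
have yc k : continuous (y k).
  by elim: k => [|k IH] /=; [exact: cst_continuous|exact: Phi_cont].
pose M : R := e * (`|F t0 x0| + 1).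
have M0 : 0 <= M by rewrite mulr_ge0 ?addr_ge0 // ltW.
have yM k t : `|y k.+1 t - y k t| <= M / 2 ^+ k.
  elim: k t => [|k IH] t.
    have [p0 dp] := PP _ (yc 0%N); rewrite expr0 divr1 /= /Phi addrC addKr.
    apply: incr p0 _ _ t => [t /e2e|t te]; first exact: dp.
    by apply: dF; apply: le_trans te _; rewrite ge_min lexx.
  by rewrite exprSr invfM mulrA; exact: (contr _ _ _ (yc k.+1) (yc k) IH t).
have /choice[x xP] (t : R) : exists l : 'rV[R]_n, forall k, `|l - y k t| <= 2 * M / 2 ^+ k.
  have /choice[l lP] (j : 'I_n) : exists l, forall k, `|l - y k t 0 j| <= 2 * M / 2 ^+ k.
    apply: geometric_limit => k; apply: le_trans (yM k t).
    by rewrite (le_trans _ (rV_norm_coord _ j)) // !mxE.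
  exists (\row_j l j) => k; apply: rV_norm_le => [|j]; last by rewrite !mxE.
  by apply: divr_ge0; [exact: mulr_ge0|exact: exprn_ge0].
have MM : 0 <= 2 * M by rewrite mulr_ge0.
have xc : continuous x.
  move=> t; apply/cvgrPdist_le => r r0.
  have r3 : 0 < r / 3 by rewrite divr_gt0.
  have [k /ltW kr] := half_pow_small MM r3.
  have /cvgrPdist_le/(_ _ r3) := yc k t; apply: filterS => s h.
  rewrite -(subrKA (y k t)) -[y k t - x s](subrKA (y k s)).
  apply: le_trans (ler_normD _ _) _; apply: le_trans (lerD (lexx _) (ler_normD _ _)) _.
  have h1 := le_trans (xP t k) kr; have := le_trans (xP s k) kr.
  rewrite distrC => h2; have : r / 3 + (r / 3 + r / 3) <= r by lra.
  by apply: le_trans; apply: lerD => //; exact: lerD.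
have xfix t : Phi x t = x t.
  apply/eqP; rewrite -subr_eq0 -normr_le0 leNgt; apply/negP => gt0.
  have [k] := half_pow_small (mulr_ge0 (ler0n R 2) MM) gt0; apply/negP; rewrite -leNgt.
  rewrite -(subrKA (y k.+1 t)); apply: le_trans (ler_normD _ _) _.
  have h1 := contr _ _ _ xc (yc k) (fun t => xP t k) t.
  have := xP t k.+1; rewrite distrC exprS invfM.
  have -> : 2 * M * (2^-1 / 2 ^+ k) = M / 2 ^+ k.
    by rewrite mulrCA mulrA mulrA mulVf ?mul1r ?pnatr_eq0.
  change (y k.+1) with (Phi (y k)).
  move: h1; set w := (2 ^+ k)^-1; move=> h1 h2.
  have : 0 <= M * w by rewrite mulr_ge0 // invr_ge0 exprn_ge0.
  lra.
exists e, x; split=> //; first by rewrite -xfix /Phi /c clamp_id ?(PP x xc).1 ?addr0 //; lra.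
move=> t te j.
have h : is_derive t (1 : R) (cst (x0 0 j) + (fun s => P x s 0 j)) (F t (x t) 0 j).
  rewrite -[X in is_derive _ _ _ X]add0r; apply: is_deriveD.
  exact: (PP x xc).2 (e2e _ (ltW te)) j.
apply: near_eq_is_derive h.
have ne : \forall s \near t, `|s - t0| < e.
  have /cvgrPdist_lt/(_ (e - `|t - t0|)) := (cvg_id : (s @[s --> t]) --> t).
  rewrite subr_gt0 => /(_ te); apply: filterS => s st.
  rewrite -(subrKA t) (le_lt_trans (ler_normD _ _)) // distrC; lra.
apply: filterS ne => s /ltW se; rewrite -[x s]xfix /Phi /c clamp_id; first by rewrite mxE.
by move: se; rewrite ler_norml; lra.
Qed.

End PicardLindelof.

Section ControlledODE.
Variable R : realType.

Lemma near_closed_ball (V : normedModType R) (x0 : V) (P : V -> Prop) :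
  (\forall x \near x0, P x) -> exists2 r : R, 0 < r & forall x, `|x - x0| <= r -> P x.
Proof.
move=> /nbhs_ballP[r /= r0 rP]; exists (r / 2); first by rewrite divr_gt0.
move=> x xr; apply: rP; rewrite -ball_normE /= distrC (le_lt_trans xr) //.
by rewrite gtr_pMr // invf_lt1 ?ltr1n.
Qed.

(** Clamping time to a segment and space to a box makes the right-hand side
    globally Lipschitz without changing it near the initial condition. *)
Lemma picard_local n (F : R -> 'rV[R]_n -> 'rV[R]_n) (t0 r K : R) x0 :
  0 < r -> 0 <= K ->
  (forall x, `|x - x0| <= r -> forall t, `|t - t0| <= r -> {for t, continuous (F^~ x)}) ->
  (forall t x x', `|t - t0| <= r -> `|x - x0| <= r -> `|x' - x0| <= r ->
    `|F t x - F t x'| <= K * `|x - x'|) ->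
  exists (e : R) (x : R -> 'rV[R]_n), [/\ 0 < e, x t0 = x0 &
    forall t, `|t - t0| < e -> [/\ `|t - t0| <= r, `|x t - x0| <= r &
      forall j, is_derive t (1 : R) (fun s => x s 0 j) (F t (x t) 0 j)]].
Proof.
move=> r0 K0 Fc FK.
pose cT := clamp (t0 - r) (t0 + r).
pose cV (x : 'rV[R]_n) : 'rV[R]_n := \row_j clamp (x0 0 j - r) (x0 0 j + r) (x 0 j).
have cTr t : `|cT t - t0| <= r.
  have : t0 - r <= cT t <= t0 + r by apply: clamp_bound; lra.
  by rewrite ler_norml; lra.
have cVr x : `|cV x - x0| <= r.
  apply: rV_norm_le => [|j]; first exact: ltW.
  rewrite !mxE; set c := clamp _ _ _.
  have : x0 0 j - r <= c <= x0 0 j + r by apply: clamp_bound; lra.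
  by rewrite ler_norml; lra.
have [||e [x [e0 xt0 dx]]] := @picard_lipschitz R n (fun t x => F (cT t) (cV x)) K t0 x0 K0.
- move=> x t; apply: (@continuous_comp _ _ _ cT (F^~ (cV x))).
    exact: clamp_continuous.
  exact: Fc.
- move=> t x x'; apply: le_trans (FK _ _ _ _ _ _) _ => //.
  rewrite ler_wpM2l //; apply: rV_norm_le => // j; rewrite !mxE.
  apply: le_trans (clamp_lipschitz _ _ _) _; first by lra.
  by apply: le_trans (rV_norm_coord _ j); rewrite !mxE.
have t0e : `|t0 - t0| < e by rewrite subrr normr0.
have xc : {for t0, continuous x}.
  by apply: rV_continuous => j; apply: is_derive_continuous (dx _ t0e j).
have [d d0 dP] : exists2 d : R, 0 < d & forall t, `|t - t0| <= d -> `|x t - x0| <= r.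
  apply: near_closed_ball; move/cvgrPdist_le/(_ _ r0): xc.
  by apply: filterS => t; rewrite xt0 distrC.
exists (Num.min e (Num.min d r)), x; split=> //; first by rewrite !lt_min e0 d0.
move=> t; rewrite !lt_min => /and3P[te /ltW td /ltW tr]; split=> // [|j]; first exact: dP.
have := dx t te j; rewrite /cT clamp_id; last by move: tr; rewrite ler_norml; lra.
suff -> : cV (x t) = x t by [].
apply/rowP => i; rewrite mxE clamp_id //.
have := le_trans (rV_norm_coord _ i) (dP t td); rewrite !mxE ler_norml; lra.
Qed.

Lemma C1_lipschitz n (I : finType) (f : I -> 'rV[R]_n -> R) (U : set 'rV[R]_n) x0 :
  open U -> (forall i, Ck_on 1 U (f i)) -> U x0 ->
  exists r K : R, [/\ 0 < r, 0 <= K, forall x, `|x - x0| <= r -> U x &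
    forall i x x', `|x - x0| <= r -> `|x' - x0| <= r ->
      `|f i x - f i x'| <= K * `|x - x'|].
Proof.
move=> oU fU Ux0.
pose B i (j : 'I_n) := `|'D_(delta_mx 0 j) (f i) x0| + 1.
have B0 i j : 0 <= B i j by rewrite addr_ge0.
have [d d0 dP] : exists2 d : R, 0 < d & forall x, `|x - x0| <= d ->
    U x /\ forall ij : I * 'I_n, `|'D_(delta_mx 0 ij.2) (f ij.1) x| <= B ij.1 ij.2.
  apply: near_closed_ball.
  have nU : nbhs x0 U by exact: open_nbhs_nbhs.
  have nd : \forall x \near x0,
      forall ij : I * 'I_n, `|'D_(delta_mx 0 ij.2) (f ij.1) x| <= B ij.1 ij.2.
    apply: (@filter_forall _ _ _ (nbhs x0)) => -[i j] /=.
    have /cvgrPdist_le/(_ _ ltr01) :=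
      Ck_on_continuous (Ck_on_derive (delta_mx 0 j) (fU i)) Ux0.
    apply: filterS => x h; rewrite /B -(subrK ('D_(delta_mx 0 j) (f i) x0) ('D__ _ x)).
    by rewrite (le_trans (ler_normD _ _)) // distrC addrC lerD2l.
  by apply: filterS2 nU nd => y; split.
have d3 : d / 3 <= d by rewrite ler_pdivrMr // ler_peMr ?ltW // ltr1n.
(* The intermediate point given by the mean value theorem may lie on either side of
   x', hence up to three radii away from x0. *)
exists (d / 3), (\sum_i \sum_j B i j); split.
- by rewrite divr_gt0.
- by apply: sumr_ge0 => i _; apply: sumr_ge0.
- by move=> x xd; apply: (dP x _).1; exact: le_trans xd d3.
move=> i x x' xd x'd.
have seg s : `|s| <= `|1 : R| -> `|s *: (x - x') + x' - x0| <= d.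
  rewrite normr1 => s1; rewrite -addrA; apply: le_trans (ler_normD _ _) _.
  have : `|s *: (x - x')| <= `|x - x0| + `|x' - x0|.
    rewrite normrZ; apply: (@le_trans _ _ `|x - x'|); first by rewrite ler_piMl.
    by rewrite -(subrKA x0) (distrC x'); exact: ler_normD.
  by move: xd x'd; rewrite -[_ / 3]/(d / 3); lra.
have [s /seg/dP[Us _]|c /seg/dP[Uc cB]] := @mean_value_dir _ _ (f i) x' (x - x') 1.
  exact: Ck_on_derivable (fU i) _ Us _.
rewrite scale1r subrK mul1r => ->.
rewrite deriveE; last exact: C1_differentiable Uc.
rewrite [X in 'd _ _ X]row_sum_delta linear_sum.
apply: le_trans (ler_norm_sum _ _ _) _.
rewrite (bigD1 i) //= mulrDl mulr_suml.
rewrite ler_wpDr ?mulr_ge0 ?sumr_ge0 // => [i' _|]; first exact: sumr_ge0.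
apply: ler_sum => j _; rewrite linearZ /= normrM mulrC ler_pM ?rV_norm_coord //.
rewrite -deriveE; first exact: (cB (i, j)).
exact: C1_differentiable Uc.
Qed.

(** The form of the right-hand side separates what is needed of time, continuity of
    the controls A i, from what is needed of space, local Lipschitz bounds on b i j. *)
Lemma control_ode m n (A : 'I_m -> R -> R) (b : 'I_m -> 'I_n -> 'rV[R]_n -> R)
    (U : set 'rV[R]_n) (t0 d : R) x0 :
  open U -> U x0 -> 0 < d ->
  (forall i t, `|t - t0| < d -> {for t, continuous (A i)}) ->
  (forall i j, Ck_on 1 U (b i j)) ->
  exists (e : R) (x : R -> 'rV[R]_n), [/\ 0 < e, x t0 = x0 &
    forall t, `|t - t0| < e -> [/\ `|t - t0| < d, U (x t) &
      forall j, is_derive t (1 : R) (fun s => x s 0 j) (\sum_i A i t * b i j (x t))]].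
Proof.
move=> oU Ux0 d0 Ac bU.
have [r [K [r0 K0 rU bK]]] :=
  @C1_lipschitz n ('I_m * 'I_n)%type (fun ij => b ij.1 ij.2) U x0 oU
    (fun ij => bU ij.1 ij.2) Ux0.
have [r1 r10 Ar1] : exists2 r : R, 0 < r & forall t, `|t - t0| <= r ->
    forall i, `|A i t| <= `|A i t0| + 1.
  apply: near_closed_ball; apply: (@filter_forall _ _ _ (nbhs t0)) => i.
  have /cvgrPdist_le/(_ _ ltr01) : {for t0, continuous (A i)}.
    by apply: Ac; rewrite subrr normr0.
  apply: filterS => t h; rewrite -(subrK (A i t0) (A i t)).
  by rewrite (le_trans (ler_normD _ _)) // distrC addrC lerD2l.
pose r2 := Num.min r (Num.min r1 (d / 2)).
have r2r : r2 <= r by rewrite ge_min lexx.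
have r2r1 : r2 <= r1 by rewrite !ge_min lexx orbT.
have r2d : r2 < d by rewrite !gt_min ltr_pdivrMr // ltr_pMr ?ltr1n // !orbT.
pose L := \sum_i (`|A i t0| + 1) * K.
have [||||e [x [e0 xt0 xP]]] := @picard_local n
  (fun t x => \row_j \sum_i A i t * b i j x) t0 r2 L x0.
- by rewrite !lt_min r0 r10 divr_gt0.
- by apply: sumr_ge0 => i _; rewrite mulr_ge0 // addr_ge0.
- move=> x xr t tr; apply: rV_continuous => j.
  have -> : (fun s => (\row_j \sum_i A i s * b i j x) 0 j) = (fun s => \sum_i A i s * b i j x).
    by apply/funext => s; rewrite mxE.
  have -> : (fun s => \sum_i A i s * b i j x) = \sum_i (fun s => A i s * b i j x).
    by apply/funext => s; rewrite fct_sumE.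
  apply: (big_ind (fun f : R -> R => {for t, continuous f})) => [|f g|i _].
  - exact: cst_continuous.
  - exact: continuousD.
  apply: continuousM; last exact: cst_continuous.
  by apply: Ac; exact: le_lt_trans tr r2d.
- move=> t x x' tr xr xr'; apply: rV_norm_le => [|j].
    by rewrite mulr_ge0 // sumr_ge0 // => i _; rewrite mulr_ge0 // addr_ge0.
  rewrite !mxE -sumrB mulr_suml; apply: le_trans (ler_norm_sum _ _ _) _.
  apply: ler_sum => i _; rewrite -mulrBr normrM -mulrA ler_pM //.
    by apply: Ar1; exact: le_trans tr r2r1.
  by apply: (bK (i, j)); [exact: le_trans xr r2r|exact: le_trans xr' r2r].
exists e, x; split=> // t te; have [tr xr dx] := xP t te; split.
- exact: le_lt_trans tr r2d.
- by apply: rU; exact: le_trans xr r2r.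
- by move=> j; have := dx j; rewrite mxE.
Qed.

Lemma is_derive_rV1 (f : R -> R) (u v : 'rV[R]_1) df :
  is_derive (u 0 0) (1 : R) f df ->
  is_derive u v (fun w : 'rV[R]_1 => f (w 0 0)) (v 0 0 * df).
Proof.
move=> [/derivable1_diffP dfu <-].
have dc : differentiable (fun w : 'rV[R]_1 => w 0 0 : R) u by exact: differentiable_coord.
have dcomp : differentiable (f \o (fun w : 'rV[R]_1 => w 0 0)) u.
  exact: differentiable_comp.
split; first exact: diff_derivable dcomp.
rewrite deriveE // (diff_comp dc dfu) /= -(deriveE v dc).
have -> : 'D_v (fun w : 'rV[R]_1 => w 0 0 : R) u = v 0 0.
  by rewrite -[RHS](congr1 (fun w : 'rV[R]_1 => w 0 0) (derive_id u v)) derive_mx ?mxE.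
by rewrite deriveE // -[X in 'd _ _ X]mulr1 linearZ.
Qed.

Lemma open_time_ball (t0 e : R) : open [set u : 'rV[R]_1 | `|u 0 0 - t0| < e].
Proof.
have -> : [set u : 'rV[R]_1 | `|u 0 0 - t0| < e] = (fun u => u 0 0) @^-1` ball t0 e.
  by apply/seteqP; split=> u; rewrite /= -ball_normE /= distrC.
by apply: open_comp => [u _|]; [exact: coord_continuous|exact: ball_open].
Qed.

(** Differentiating the equation expresses the derivative of a solution through
    the solution itself, so each order of smoothness yields the next one. *)
Lemma control_ode_smooth m n (A : 'I_m -> R -> R) (b : 'I_m -> 'I_n -> 'rV[R]_n -> R)
    (U : set 'rV[R]_n) (t0 e : R) (x : R -> 'rV[R]_n) :
  open U ->
  let W := [set u : 'rV[R]_1 | `|u 0 0 - t0| < e] in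
  (forall i, Cinfty_on W (fun u => A i (u 0 0))) ->
  (forall i j, Cinfty_on U (b i j)) ->
  (forall t, `|t - t0| < e -> U (x t) /\
      forall j, is_derive t (1 : R) (fun s => x s 0 j) (\sum_i A i t * b i j (x t))) ->
  forall j, Cinfty_on W (fun u => x (u 0 0) 0 j).
Proof.
move=> oU W AW bU xP j k.
have oW : open W by exact: open_time_ball.
have dx u v i : W u -> is_derive u v (fun w : 'rV[R]_1 => x (w 0 0) 0 i)
    (v 0 0 * \sum_l A l (u 0 0) * b l i (x (u 0 0))).
  by move=> Wu; apply: (is_derive_rV1 (f := fun s => x s 0 i)); exact: (xP _ Wu).2.
have xc u i : W u -> {for u, continuous (fun w : 'rV[R]_1 => x (w 0 0) 0 i)}.
  move=> Wu; apply: (@continuous_comp _ _ _ (fun w : 'rV[R]_1 => w 0 0) (fun s => x s 0 i)).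
    exact: coord_continuous.
  exact: is_derive_continuous ((xP _ Wu).2 i).
elim: k j => [|k IH] j; first by split=> // u; exact: xc.
split=> [u|v]; first exact: xc.
split=> [u Wu|]; first by have [] := dx u v j Wu.
have h : Ck_on k W (fun u => v 0 0 * \sum_l A l (u 0 0) * b l j (x (u 0 0))).
  apply: Ck_onM => //; first exact: Ck_on_cst.
  apply: Ck_on_sum => // l; apply: Ck_onM => //; first exact: AW.
  apply: (@Ck_on_comp R k 1 n U W (b l j) (fun u => x (u 0 0))) => //; last exact: bU.
  by move=> u Wu; exact: (xP _ Wu).1.
by apply: Ck_on_ext oW _ h => u Wu; have [_ ->] := dx u v j Wu.
Qed.

End ControlledODE.

(** * Smooth maps and differentials on manifolds *)

Section SmoothAt.
Variable R : realType.
Implicit Types M N L : manifoldType R.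

(** The conditions in Ck_on are imposed point by point, on total functions. *)
Lemma Ck_on_local n k (S : set 'rV[R]_n) (f : 'rV[R]_n -> R) :
  (forall x, S x -> exists2 V : set 'rV[R]_n, V x & Ck_on k V f) -> Ck_on k S f.
Proof.
elim: k f => [|k IH] f SV.
  by split=> // x /SV[V Vx fV]; apply: (Ck_on_continuous fV).
split=> [x /SV[V Vx fV]|v]; first by apply: (Ck_on_continuous fV).
split=> [x /SV[V Vx fV]|]; first exact: Ck_on_derivable fV _ Vx _.
by apply: IH => x /SV[V Vx fV]; exists V => //; exact: Ck_on_derive.
Qed.

(** Smoothness of the germ of f at p.  Unlike smoothness on a fixed open set it
    composes without tracking domains, which suits curves and local sections given by
    total functions. *)
Definition smooth_at M N (f : M -> N) (p : M) : Prop :=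
  exists W, [/\ open W, W p & smooth_open W f].

Lemma smooth_openP M N (W : set M) (f : M -> N) :
  smooth_open W f -> open W -> forall p, W p -> smooth_at f p.
Proof. by move=> fW oW p Wp; exists W. Qed.

Lemma smooth_smooth_at M N (f : M -> N) p : smooth f -> smooth_at f p.
Proof. by move=> sf; exists setT; split=> //; exact: openT. Qed.

Lemma smooth_at_continuous M N (f : M -> N) p : smooth_at f p -> {for p, continuous f}.
Proof. by case=> W [_ Wp [fc _]]; exact: fc. Qed.

Lemma smooth_at_near M N (f : M -> N) p :
  smooth_at f p -> \forall q \near p, smooth_at f q.
Proof.
by case=> W [oW Wp fW]; apply: filterS (open_nbhs_nbhs (conj oW Wp)) => q Wq; exists W.
Qed.

Definition chart_overlap M N (W : set M) (f : M -> N)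
    (phi : chart R M (mdim M)) (psi : chart R N (mdim N)) : set 'rV[R]_(mdim M) :=
  [set x | [/\ chart_img phi x, W (chart_inv phi x)
             & chart_dom psi (f (chart_inv phi x))]].

Lemma chart_img_invP M (phi : chart R M (mdim M)) x :
  chart_img phi x -> chart_dom phi (chart_inv phi x) /\ phi (chart_inv phi x) = x.
Proof. by case=> p dp <-; rewrite chart_invK. Qed.

Lemma chart_overlap_open M N (W : set M) (f : M -> N) phi psi : open W ->
  (forall p, W p -> {for p, continuous f}) -> open (chart_overlap W f phi psi).
Proof.
move=> oW fc; rewrite openE => x [ix Wx dx].
have ic := chart_inv_cont ix.
have n1 : nbhs x (chart_img phi) by apply: open_nbhs_nbhs; split=> //; exact: chart_img_open.
have n2 : \forall y \near x, W (chart_inv phi y).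
  by apply: ic; exact: open_nbhs_nbhs.
have n3 : \forall y \near x, chart_dom psi (f (chart_inv phi y)).
  apply: (continuous_comp ic (fc _ Wx)); apply: open_nbhs_nbhs; split=> //.
  exact: chart_dom_open.
apply: filterS2 (filterI n1 n2) n3 => y [? ?] ?; split=> //.
Qed.

Lemma smooth_at_ext M N (f g : M -> N) p :
  {near p, f =1 g} -> smooth_at f p -> smooth_at g p.
Proof.
move=> fg [W [oW Wp [fc fs]]].
have [V [[oV Vp] VS]] : exists V, open_nbhs p V /\ V `<=` [set q | f q = g q].
  by move: fg; rewrite /prop_near1 nbhsE /= => -[V ? ?]; exists V.
have gc q : (W `&` V) q -> {for q, continuous g}.
  move=> [Wq Vq]; rewrite /prop_for /continuous_at -(VS _ Vq).
  apply: cvg_trans (fc _ Wq); apply: (@near_eq_cvg _ _ (nbhs q)).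
  by apply: filterS (open_nbhs_nbhs (conj oV Vq)) => r /VS.
exists (W `&` V); split=> //; first exact: openI.
split=> // phi psi aphi apsi j k.
apply: (@Ck_on_ext _ _ k _ (fun x => psi (f (chart_inv phi x)) 0 j)).
- by apply: (@chart_overlap_open M N (W `&` V) g phi psi) => //; exact: openI.
- by move=> x [_ [_ /VS /= ->] _].
apply: Cinfty_on_sub (fs phi psi aphi apsi j) k.
by move=> x [ix [Wx Vx] dx]; split=> //; rewrite (VS _ Vx).
Qed.

Lemma smooth_at_cst M N (q : N) (p : M) : smooth_at (fun=> q) p.
Proof.
exists setT; split=> //; first exact: openT.
by split=> [r _|phi psi _ _ j k]; [exact: cst_continuous|exact: Ck_on_cst].
Qed.

Lemma smooth_at_id M (p : M) : smooth_at (fun q : M => q) p.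
Proof.
exists setT; split=> //; first exact: openT.
split=> [r _|phi psi aphi apsi j]; first exact: cvg_id.
have h := atlas_compatible phi psi aphi apsi.
by apply: Cinfty_on_sub (h j) => x [].
Qed.

(** Near each point the composite, read in two charts, factors through a chart of the
    middle manifold. *)
Lemma smooth_at_comp L M N (f : M -> N) (g : L -> M) p :
  smooth_at f (g p) -> smooth_at g p -> smooth_at (fun q => f (g q)) p.
Proof.
move=> [Wf [oWf Wfp [fc fs]]] [Wg [oWg Wgp [gc gs]]].
pose W := Wg `&` g @^-1` Wf.
have oW : open W.
  rewrite openE => q [Wq fq]; apply: filterI; first exact: open_nbhs_nbhs.
  by apply: gc => //; exact: open_nbhs_nbhs.
have fgc q : W q -> {for q, continuous (fun r => f (g r))}.
  by move=> [Wq fq]; apply: (@continuous_comp _ _ _ g f); [exact: gc|exact: fc].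
exists W; split=> //; split=> // phi psi aphi apsi j k.
apply: Ck_on_local => x [ix [Wgx Wfx] dx].
pose chi := chart_at (g (chart_inv phi x)).
pose V := chart_overlap W (fun q => f (g q)) phi psi `&` chart_overlap Wg g phi chi.
have oV : open V by apply: openI; exact: chart_overlap_open.
exists V; first by do 2!split=> //; exact: chart_at_dom.
pose U := chart_overlap Wf f chi psi.
have oU : open U by exact: chart_overlap_open.
have gK y : V y -> chart_inv chi (chi (g (chart_inv phi y))) = g (chart_inv phi y).
  by move=> [_ [_ _ d]]; exact: chart_invK.
apply: (@Ck_on_ext _ _ k _ (fun y => psi (f (chart_inv chi (chi (g (chart_inv phi y))))) 0 j)).
- exact: oV.
- by move=> y Vy; rewrite gK.
apply: (@Ck_on_comp R k _ _ U V (fun z => psi (f (chart_inv chi z)) 0 j)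
  (fun y => chi (g (chart_inv phi y)))) => //.
- move=> y Vy; have [[iy [_ Wfy] dy] [_ _ d]] := Vy.
  by split; rewrite ?gK //; exists (g (chart_inv phi y)).
- move=> i; apply: Cinfty_on_sub (gs phi chi aphi (chart_at_atlas _) i) k.
  by move=> y [].
exact: (fs chi psi (chart_at_atlas _) apsi j k).
Qed.

Lemma smooth_at_pair L M N (f : L -> M) (g : L -> N) p :
  smooth_at f p -> smooth_at g p -> smooth_at (fun q => (f q, g q)) p.
Proof.
move=> [Wf [oWf Wfp [fc fs]]] [Wg [oWg Wgp [gc gs]]].
exists (Wf `&` Wg); split=> //; first exact: openI.
split=> [q [Wfq Wgq]|phi _ aphi [[psi chi] [/= apsi achi] ->] j].
  exact: (cvg_pair (fc _ Wfq) (gc _ Wgq)).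
rewrite -(splitK j); case: (fintype.split j) => i /=.
  have -> : (fun x => prod_chart_fun psi chi (f (chart_inv phi x), g (chart_inv phi x)) 0
      (lshift _ i)) = (fun x => psi (f (chart_inv phi x)) 0 i).
    by apply/funext => x; rewrite row_mxEl.
  apply: Cinfty_on_sub (fs phi psi aphi apsi i) => x.
  by case=> ? [? ?] [? ?].
have -> : (fun x => prod_chart_fun psi chi (f (chart_inv phi x), g (chart_inv phi x)) 0
    (rshift _ i)) = (fun x => chi (g (chart_inv phi x)) 0 i).
  by apply/funext => x; rewrite row_mxEr.
apply: Cinfty_on_sub (gs phi chi aphi achi i) => x.
by case=> ? [? ?] [? ?].
Qed.

End SmoothAt.

Section TangentMaps.
Variable R : realType.
Implicit Types M N L : manifoldType R.

Lemma smooth_at_differentiable M N (f : M -> N) p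
    (phi : chart R M (mdim M)) (psi : chart R N (mdim N)) :
  smooth_at f p -> atlas phi -> atlas psi -> chart_dom phi p -> chart_dom psi (f p) ->
  differentiable (psi \o f \o chart_inv phi) (phi p).
Proof.
move=> [W [oW Wp [fc fs]]] aphi apsi dp dfp.
apply: (@C1_differentiable_rV _ _ _ (chart_overlap W f phi psi)).
- exact: chart_overlap_open.
- by move=> j; exact: (fs phi psi aphi apsi j 1%N).
- by split; rewrite ?chart_invK //; exists p.
Qed.

Lemma near_eq_diff (V W : normedModType R) (f g : V -> W) x v :
  {near x, f =1 g} -> differentiable f x -> differentiable g x ->
  'd f x v = 'd g x v.
Proof. by move=> fg df dg; rewrite -!deriveE //; exact: near_eq_derive. Qed.

Lemma near_chart_inv M (phi : chart R M (mdim M)) p (P : M -> Prop) :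
  chart_dom phi p -> (\forall q \near p, P q) -> \forall x \near phi p, P (chart_inv phi x).
Proof.
move=> dp nP; have ip : chart_img phi (phi p) by exists p.
by apply: (chart_inv_cont ip); rewrite chart_invK.
Qed.

Lemma near_chart_dom M (phi : chart R M (mdim M)) p :
  chart_dom phi p -> \forall q \near p, chart_dom phi q.
Proof. by move=> dp; apply: open_nbhs_nbhs; split=> //; exact: chart_dom_open. Qed.

Lemma tdiff_comp L M N (f : M -> N) (g : L -> M) p v :
  smooth_at f (g p) -> smooth_at g p ->
  tdiff (fun q => f (g q)) p v = tdiff f (g p) (tdiff g p v).
Proof.
move=> sf sg; have sfg := smooth_at_comp sf sg.
pose phi := chart_at p; pose psi := chart_at (g p); pose chi := chart_at (f (g p)).
have dphi : chart_dom phi p := chart_at_dom p.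
have dpsi : chart_dom psi (g p) := chart_at_dom _.
have dchi : chart_dom chi (f (g p)) := chart_at_dom _.
have dg := smooth_at_differentiable sg (chart_at_atlas _) (chart_at_atlas _) dphi dpsi.
have df := smooth_at_differentiable sf (chart_at_atlas _) (chart_at_atlas _) dpsi dchi.
have dfg := smooth_at_differentiable sfg (chart_at_atlas _) (chart_at_atlas _) dphi dchi.
have gE : (psi \o g \o chart_inv phi) (phi p) = psi (g p) by rewrite /= chart_invK.
rewrite -gE in df.
rewrite /tdiff -/phi -/psi -/chi -gE.
have dc := diff_comp dg df.
transitivity ('d ((chi \o f \o chart_inv psi) \o (psi \o g \o chart_inv phi)) (phi p) v).
  apply: near_eq_diff => //; last exact: differentiable_comp.
  have := near_chart_inv dphi (smooth_at_continuous sg (near_chart_dom dpsi)).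
  by apply: filterS => x dx /=; rewrite (chart_invK dx).
by rewrite dc.
Qed.

Lemma tdiff_ext M N (f g : M -> N) p v :
  {near p, f =1 g} -> smooth_at f p -> tdiff f p v = tdiff g p v.
Proof.
move=> fg sf; have sg := smooth_at_ext fg sf.
have fgp : f p = g p by exact: nbhs_singleton fg.
have dp := chart_at_dom p.
rewrite /tdiff -fgp; apply: near_eq_diff.
- by apply: filterS (near_chart_inv dp fg) => x /= ->.
- by apply: smooth_at_differentiable => //; exact: chart_at_atlas || exact: chart_at_dom.
- apply: smooth_at_differentiable => //; do ?[exact: chart_at_atlas].
  by rewrite -fgp; exact: chart_at_dom.
Qed.

Lemma tdiff_id M (p : M) v : tdiff (fun q : M => q) p v = v.
Proof.
have dp := chart_at_dom p.
transitivity ('d (id : 'rV[R]_(mdim M) -> 'rV[R]_(mdim M)) (chart_at p p) v); last first.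
  by rewrite diff_val.
rewrite /tdiff.
apply: near_eq_diff => //; last first.
  by apply: smooth_at_differentiable; [exact: smooth_at_id|exact: chart_at_atlas|
    exact: chart_at_atlas|exact: dp|exact: dp].
have nimg : nbhs (chart_at p p) (chart_img (chart_at p)).
  by apply: open_nbhs_nbhs; split; [exact: chart_img_open|exists p].
apply: filterS nimg => x ix /=.
by rewrite (chart_img_invP ix).2.
Qed.

Lemma tdiff_cst M N (q : N) (p : M) v : tdiff (fun=> q) p v = 0.
Proof. by rewrite /tdiff (_ : _ \o _ = cst (chart_at q q)) // diff_cst. Qed.

Lemma tdiffE M N (f : M -> N) p v : smooth_at f p ->
  tdiff f p v = \row_j 'D_v (fun x => chart_at (f p) (f (chart_inv (chart_at p) x)) 0 j)
    (chart_at p p).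
Proof.
move=> sf; have df := smooth_at_differentiable sf (chart_at_atlas _) (chart_at_atlas _)
  (chart_at_dom p) (chart_at_dom (f p)).
rewrite /tdiff -deriveE // derive_mx; last exact: diff_derivable.
by apply/rowP => j; rewrite !mxE.
Qed.

Lemma tdiff_rVE M n (f : M -> 'rV[R]_n) p v : smooth_at f p ->
  tdiff f p v = \row_j 'D_v (fun x => f (chart_inv (chart_at p) x) 0 j) (chart_at p p).
Proof. exact: tdiffE. Qed.

Lemma tdiff_pair L M N (f : L -> M) (g : L -> N) p v :
  smooth_at f p -> smooth_at g p ->
  tdiff (fun q => (f q, g q)) p v = row_mx (tdiff f p v) (tdiff g p v).
Proof.
move=> sf sg; rewrite (tdiffE _ (smooth_at_pair sf sg)) (tdiffE _ sf) (tdiffE _ sg).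
apply/rowP => j; rewrite !mxE -(splitK j); case: (fintype.split j) => i.
  rewrite (unsplitK (inl i)) mxE; congr ('D_v _ _); apply/funext => x.
  by rewrite /= row_mxEl.
rewrite (unsplitK (inr i)) mxE; congr ('D_v _ _); apply/funext => x.
by rewrite /= row_mxEr.
Qed.

Lemma tdiff_pairl M N (p : M) (q : N) v :
  tdiff (fun r : M => (r, q)) p v = row_mx v 0.
Proof.
by rewrite tdiff_pair ?tdiff_id ?tdiff_cst //; [exact: smooth_at_id|exact: smooth_at_cst].
Qed.

Lemma tdiff_pairr M N (p : M) (q : N) w :
  tdiff (fun r : N => (p, r)) q w = row_mx 0 w.
Proof.
by rewrite tdiff_pair ?tdiff_id ?tdiff_cst //; [exact: smooth_at_cst|exact: smooth_at_id].
Qed.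

Lemma smooth_at_slicel M N L (F : M * N -> L) p q :
  smooth_at F (p, q) -> smooth_at (fun r => F (r, q)) p.
Proof.
move=> sF; apply: (@smooth_at_comp _ _ _ _ F (fun r => (r, q))) => //.
by apply: smooth_at_pair; [exact: smooth_at_id|exact: smooth_at_cst].
Qed.

Lemma smooth_at_slicer M N L (F : M * N -> L) p q :
  smooth_at F (p, q) -> smooth_at (fun r => F (p, r)) q.
Proof.
move=> sF; apply: (@smooth_at_comp _ _ _ _ F (fun r => (p, r))) => //.
by apply: smooth_at_pair; [exact: smooth_at_cst|exact: smooth_at_id].
Qed.

(** The Leibniz rule: (v, w) = (v, 0) + (0, w), and each summand is tangent to a slice
    of the product. *)
Lemma tdiff_pair_comp (K : manifoldType R) L M N (F : M * N -> L)
    (f : K -> M) (g : K -> N) p v :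
  smooth_at F (f p, g p) -> smooth_at f p -> smooth_at g p ->
  tdiff (fun r => F (f r, g r)) p v =
  tdiff (fun a => F (a, g p)) (f p) (tdiff f p v) +
  tdiff (fun b => F (f p, b)) (g p) (tdiff g p v).
Proof.
move=> sF sf sg.
rewrite (@tdiff_comp _ _ _ F (fun r => (f r, g r))) //; last exact: smooth_at_pair.
rewrite tdiff_pair //.
rewrite (@tdiff_comp _ _ _ F (fun a => (a, g p))) //; last first.
  by apply: smooth_at_pair; [exact: smooth_at_id|exact: smooth_at_cst].
rewrite (@tdiff_comp _ _ _ F (fun b => (f p, b))) //; last first.
  by apply: smooth_at_pair; [exact: smooth_at_cst|exact: smooth_at_id].
rewrite tdiff_pairl tdiff_pairr -linearD; congr (tdiff _ _ _).
by rewrite add_row_mx addr0 add0r.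
Qed.

End TangentMaps.

(** * Curves and their velocities *)

Section Curves.
Variable R : realType.
Implicit Types M N L : manifoldType R.

(* The differential of a curve is taken on row vectors of length 1, the chart of the
   line being const_mx; the velocity is an ordinary derivative.  The next three facts
   relate the two. *)
Let curve_on_line M (c : R -> M) (t : R)
    (F := chart_at (c t) \o c \o (fun u : 'rV[R]_1 => u 0 0)) :
  chart_at (c t) \o c = (fun s : R => F (s *: const_mx 1 + 0)).
Proof.
by apply/funext => s; rewrite /F /= addr0 scalemx_const mulr1 mxE.
Qed.

Let line1E (t : R) : t *: (const_mx 1 : 'rV[R]_1) + 0 = const_mx t.
Proof. by rewrite addr0 scalemx_const mulr1. Qed.

Let curve_is_derive M (c : R -> M) (t : R)
    (F := chart_at (c t) \o c \o (fun u : 'rV[R]_1 => u 0 0)) :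
  smooth_at (M := R^o) c t ->
  is_derive t (1 : R) (chart_at (c t) \o c) ('d F (const_mx t) (const_mx 1)).
Proof.
move=> sc; have dF : differentiable F (const_mx t).
  exact: (smooth_at_differentiable sc (chart_at_atlas (t : R^o)) (chart_at_atlas (c t))
    (chart_at_dom (t : R^o)) (chart_at_dom (c t))).
rewrite curve_on_line -/F -(line1E t) -deriveE; last by rewrite line1E.
by apply: derive_line; rewrite line1E; exact: diff_derivable.
Qed.

Lemma smooth_at_derivable M (c : R -> M) (t : R) :
  smooth_at (M := R^o) c t -> derivable (chart_at (c t) \o c) t (1 : R).
Proof. by move=> /curve_is_derive[]. Qed.

Lemma velocityE M (c : R -> M) (t : R) : smooth_at (M := R^o) c t ->
  velocity c t = tdiff (M := R^o) c t (const_mx 1).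
Proof. by move=> /curve_is_derive[_ <-]; rewrite /velocity derive1E. Qed.

Lemma velocity_comp M N (f : M -> N) (c : R -> M) (t : R) :
  smooth_at f (c t) -> smooth_at (M := R^o) c t ->
  velocity (fun s => f (c s)) t = tdiff f (c t) (velocity c t).
Proof.
move=> sf sc; rewrite !velocityE //; last exact: smooth_at_comp.
exact: tdiff_comp.
Qed.

Lemma velocity_pair_comp M N L (F : M * N -> L) (a : R -> M) (b : R -> N) (t : R) :
  smooth_at F (a t, b t) -> smooth_at (M := R^o) a t -> smooth_at (M := R^o) b t ->
  velocity (fun s => F (a s, b s)) t =
  tdiff (fun p => F (p, b t)) (a t) (velocity a t) +
  tdiff (fun q => F (a t, q)) (b t) (velocity b t).
Proof.
move=> sF sa sb; rewrite !velocityE //; last first.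
  by apply: (@smooth_at_comp R R^o _ _ F (fun s => (a s, b s))) => //; exact: smooth_at_pair.
exact: tdiff_pair_comp.
Qed.

Lemma velocity_ext M (c c' : R -> M) (t : R) :
  {near t, c =1 c'} -> smooth_at (M := R^o) c t -> velocity c t = velocity c' t.
Proof.
move=> cc' sc; have sc' : smooth_at (M := R^o) c' t.
  exact: (@smooth_at_ext R R^o M c c' t cc' sc).
rewrite (velocityE sc) (velocityE sc').
exact: (@tdiff_ext R R^o M c c' t _ cc' sc).
Qed.

Lemma smooth_at_chart_inv M (psi : chart R M (mdim M)) x :
  atlas psi -> chart_img psi x -> smooth_at (chart_inv psi) x.
Proof.
move=> apsi ix; exists (chart_img psi); split=> //; first exact: chart_img_open.
split=> [y iy|phi chi -> achi j]; first exact: chart_inv_cont.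
have h := atlas_compatible psi chi apsi achi.
by apply: Cinfty_on_sub (h j) => y [].
Qed.

Lemma smooth_at_chart M (psi : chart R M (mdim M)) p :
  atlas psi -> chart_dom psi p -> smooth_at (psi : M -> 'rV[R]_(mdim M)) p.
Proof.
move=> apsi dp; exists (chart_dom psi); split=> //; first exact: chart_dom_open.
split=> [q dq|phi chi aphi -> j]; first exact: chart_cont.
have h := atlas_compatible phi psi aphi apsi.
by apply: Cinfty_on_sub (h j) => x [].
Qed.

Lemma open_time_set (t0 d : R) : open [set t : R | `|t - t0| < d].
Proof.
have -> : [set t : R | `|t - t0| < d] = ball t0 d.
  by apply/seteqP; split=> u; rewrite /= -ball_normE /= distrC.
exact: ball_open.
Qed.

Lemma smooth_at_rV_curve n (x : R -> 'rV[R]_n) (t0 d : R) :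
  (forall j, Cinfty_on [set u : 'rV[R]_1 | `|u 0 0 - t0| < d] (fun u => x (u 0 0) 0 j)) ->
  forall t, `|t - t0| < d -> smooth_at (M := R^o) x t.
Proof.
move=> xs t td; exists [set t : R^o | `|t - t0| < d]; split=> //.
  exact: open_time_set.
split=> [s sd|phi psi -> -> j].
  apply: rV_continuous => j.
  have -> : (fun s => x s 0 j) = (fun u : 'rV[R]_1 => x (u 0 0) 0 j) \o const_mx.
    by apply/funext => r; rewrite /= mxE.
  apply: continuous_comp; first exact: const_mx_continuous.
  by apply: (Ck_on_continuous (xs j 0%N)); rewrite /= mxE.
by apply: Cinfty_on_sub (xs j) => u [].
Qed.

Lemma smooth_at_curve_chart M (c : R -> M) (t0 : R) (phi : chart R M (mdim M)) :
  smooth_at (M := R^o) c t0 -> atlas phi -> chart_dom phi (c t0) ->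
  exists2 d : R, 0 < d & (forall t, `|t - t0| < d ->
      smooth_at (M := R^o) c t /\ chart_dom phi (c t)) /\
    forall j, Cinfty_on [set u : 'rV[R]_1 | `|u 0 0 - t0| < d]
      (fun u => phi (c (u 0 0)) 0 j).
Proof.
move=> [W [oW Wt0 cs]] aphi dphi.
have n1 : \forall t \near t0, W t by exact: open_nbhs_nbhs.
have n2 : \forall t \near t0, chart_dom phi (c t).
  exact: (cs.1 _ Wt0 _ (near_chart_dom dphi)).
have [d d0 dP] := near_closed_ball (filterI n1 n2).
exists d => //; split=> [t /ltW/dP[Wt dt]|j]; first by split=> //; exists W.
apply: Cinfty_on_sub (cs.2 _ phi (chart_at_atlas (t0 : R^o)) aphi j) => u /ltW/dP[Wu du].
by split=> //; exists (u 0 0) => //; apply/rowP => i; rewrite mxE (ord1 i).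
Qed.

Lemma tdiff_rV n N (f : 'rV[R]_n -> N) x v : tdiff f x v = 'd (chart_at (f x) \o f) x v.
Proof. by []. Qed.

Lemma velocity_chart M (c : R -> M) (t : R) (phi : chart R M (mdim M)) :
  smooth_at (M := R^o) c t -> atlas phi -> chart_dom phi (c t) ->
  velocity c t = tdiff (chart_inv phi) (phi (c t))
    (\row_i 'D_(const_mx 1) (fun u : 'rV[R]_1 => phi (c (u 0 0)) 0 i) (const_mx t)).
Proof.
move=> sc aphi dphi; have iphi : chart_img phi (phi (c t)) by exists (c t).
have sphi := smooth_at_chart aphi dphi.
have sinv := smooth_at_chart_inv aphi iphi.
have sphic : smooth_at (M := R^o) (fun s => phi (c s)) t by exact: smooth_at_comp.
have sE : smooth_at (M := R^o) (fun s => chart_inv phi (phi (c s))) t.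
  exact: smooth_at_comp.
have E : {near t, (fun s => chart_inv phi (phi (c s))) =1 c}.
  have nE : \forall s \near t, chart_dom phi (c s).
    exact: (smooth_at_continuous sc (near_chart_dom dphi)).
  by apply: filterS nE => s ds; rewrite /= chart_invK.
rewrite -(velocity_ext E sE) (velocity_comp sinv sphic); congr (tdiff _ _ _).
by rewrite (velocityE sphic) (tdiffE _ sphic).
Qed.

(** In a chart, both the coefficients of the form and the coordinates of the
    velocity are smooth. *)
Lemma smooth_form_velocity M k (om : M -> {linear 'rV[R]_(mdim M) -> 'rV[R]_k})
    (c : R -> M) (t0 : R) :
  smooth_form om -> smooth_at (M := R^o) c t0 ->
  exists2 d : R, 0 < d & forall j, Cinfty_on [set u : 'rV[R]_1 | `|u 0 0 - t0| < d]
    (fun u => om (c (u 0 0)) (velocity c (u 0 0)) 0 j).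
Proof.
move=> som sc; pose phi := chart_at (c t0).
have aphi : atlas phi by exact: chart_at_atlas.
have [d d0 [dP Y]] := smooth_at_curve_chart sc aphi (chart_at_dom _).
exists d => // j r.
pose W := [set u : 'rV[R]_1 | `|u 0 0 - t0| < d].
have oW : open W by exact: open_time_ball.
pose coef i x := om (chart_inv phi x)
  ('d (chart_at (chart_inv phi x) \o chart_inv phi) x (delta_mx 0 i)) 0 j.
have h : Ck_on r W (fun u => \sum_i
    'D_(const_mx 1) (fun u : 'rV[R]_1 => phi (c (u 0 0)) 0 i) u * coef i (phi (c (u 0 0)))).
  apply: Ck_on_sum => // i; apply: Ck_onM => //.
    exact: Ck_on_derive (Y i r.+1).
  apply: (@Ck_on_comp R r 1 _ (chart_img phi) W (coef i) (fun u => phi (c (u 0 0)))) => //.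
  - exact: chart_img_open.
  - by move=> u /dP[_ du]; exists (c (u 0 0)).
  - by move=> i'; exact: Y.
  - exact: som.
apply: (Ck_on_ext oW _ h) => u Wu; have [su du] := dP _ Wu.
rewrite (velocity_chart su aphi du).
have -> : const_mx (u 0 0) = u by apply/rowP => i; rewrite mxE (ord1 i).
rewrite tdiff_rV; set w := matrix_of_fun _ _; rewrite [w]row_sum_delta !linear_sum summxE.
by apply: eq_bigr => i _; rewrite !linearZ !mxE /coef chart_invK.
Qed.

End Curves.

Section Segments.
Variable R : realType.

(** The supremum of the points that can be reached from a is itself reached, by the
    local hypothesis at that point, which would also allow to pass beyond it if it lay
    before b. *)
Lemma segment_chain (Q : R -> R -> Prop) (a b : R) : a <= b ->
  (forall x y z, a <= x -> x <= y -> y <= z -> z <= b -> Q x y -> Q y z -> Q x z) ->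
  (forall t, a <= t <= b -> exists2 e : R, 0 < e & forall x y,
      a <= x -> x <= y -> y <= b -> t - e < x -> y < t + e -> Q x y) ->
  Q a b.
Proof.
move=> ab Qt Qloc; pose S := [set t | [/\ a <= t, t <= b & Q a t]].
have Sa : S a.
  have [|e e0 eQ] := Qloc a; first by rewrite lexx.
  by split=> //; apply: eQ => //; lra.
have hS : has_sup S by split; [exists a|exists b => t []].
have s1 : a <= sup S by apply: (ub_le_sup hS.2).
have s2 : sup S <= b by apply: ge_sup; [exists a|move=> t []].
have [|e e0 eQ] := Qloc (sup S); first by rewrite s1.
have [t [at_ tb Qat] ts] := sup_adherent e0 hS.
have tS : t <= sup S by apply: (ub_le_sup hS.2).
have Qs : Q a (sup S) by apply: (Qt a t) => //; apply: eQ => //; lra.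
have [sb|sb] := leP b (sup S); first by have <- : sup S = b by lra.
pose y := Num.min b (sup S + e / 2).
have [y1 [y2 y3]] : sup S < y /\ y <= b /\ y < sup S + e.
  by rewrite /y; have [] := leP b (sup S + e / 2); lra.
have Sy : S y.
  split; [lra|by []|].
  by apply: (Qt a (sup S)) => //; [lra|apply: eQ => //; lra].
have : y <= sup S by apply: (ub_le_sup hS.2).
lra.
Qed.

End Segments.

Section SmoothOn.
Variable R : realType.
Implicit Types M N L : manifoldType R.

Lemma smooth_onP M N (S : set M) (f : M -> N) :
  smooth_on S f <-> forall p, S p ->
    exists2 g, smooth_at g p & \forall q \near p, S q -> g q = f q.
Proof.
split=> [sf p /sf[W [g [oW Wp gs gE]]]|sf p /sf[g [W [oW Wp gs]] gE]].
  by exists g; [exists W|apply: filterS (open_nbhs_nbhs (conj oW Wp))].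
move: gE; rewrite /prop_near1 nbhsE => -[V [oV Vp] VE].
exists (W `&` V), g; split=> //; first exact: openI.
  split=> [q [Wq _]|phi psi aphi apsi j]; first exact: gs.1.
  by apply: Cinfty_on_sub (gs.2 phi psi aphi apsi j) => x [? []].
by move=> q [_ /VE]; exact.
Qed.

Lemma smooth_on_comp L M N (S : set L) (f : M -> N) (g : L -> M) :
  smooth_on S g -> (forall p, S p -> smooth_at f (g p)) ->
  smooth_on S (fun p => f (g p)).
Proof.
move=> /smooth_onP sg sf; apply/smooth_onP => p Sp; have [h sh hE] := sg p Sp.
exists (fun q => f (h q)); last by apply: filterS hE => q hE /hE ->.
by apply: smooth_at_comp => //; rewrite (nbhs_singleton hE Sp); exact: sf.
Qed.

Lemma smooth_on_interior M N (S : set M) (f : M -> N) p :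
  smooth_on S f -> nbhs p S -> smooth_at f p.
Proof.
move=> /smooth_onP sf nS; have [g sg gE] := sf p (nbhs_singleton nS).
by apply: smooth_at_ext sg; apply: filterS2 nS gE => q Sq; exact.
Qed.

Lemma smooth_at_smooth_on M N (S : set M) (f : M -> N) :
  (forall p, S p -> smooth_at f p) -> smooth_on S f.
Proof.
move=> sf; apply/smooth_onP => p Sp; exists f; first exact: sf.
exact: nearW.
Qed.

Lemma near_open_itv (a b t : R) : a < t < b -> \forall s \near t, a < s < b.
Proof.
move=> tab; have : nbhs t [set` `]a, b[%R].
  by apply: open_nbhs_nbhs; split; [exact: interval_open|rewrite /= in_itv].
by apply: filterS => s; rewrite /= in_itv.
Qed.

(** Read in a chart, the derivative vanishes, so the curve is constant near every
    point of the segment. *)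
Lemma velocity0_cst N (c : R -> N) (a b : R) : a <= b ->
  smooth_on (M := R^o) [set t : R^o | a <= t <= b] c ->
  (forall t, a < t < b -> velocity c t = 0) -> c a = c b.
Proof.
move=> ab sc dc; apply: (@segment_chain R (fun x y => c x = c y)) => // [x y z _ _ _ _ ->//|].
move=> t tab; have /smooth_onP/(_ t tab)[g sg gE] := sc.
have gt : g t = c t by exact: (nbhs_singleton gE).
pose psi := chart_at (c t).
have dpsi : chart_dom psi (g t) by rewrite gt; exact: chart_at_dom.
have [e e0 eP] : exists2 e : R, 0 < e & forall s, `|s - t| <= e ->
    [/\ smooth_at (M := R^o) g s, chart_dom psi (g s) & a <= s <= b -> g s = c s].
  apply: near_closed_ball.
  have n1 := smooth_at_near sg.
  have n2 := smooth_at_continuous sg (near_chart_dom dpsi).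
  by apply: filterS2 (filterI n1 n2) gE => s [].
exists e => // x y ax xy yb xt yt.
have in_e s : x <= s <= y -> `|s - t| <= e by rewrite ler_norml; lra.
have sx s : x <= s <= y -> smooth_at (M := R^o) (fun s => psi (g s)) s.
  move=> /in_e/eP[sgs ds _]; apply: smooth_at_comp => //.
  by apply: smooth_at_chart => //; exact: chart_at_atlas.
have d0 s : x < s < y -> forall j, is_derive s (1 : R) (fun s => psi (g s) 0 j) 0.
  move=> sxy j; have /in_e/eP[sgs ds _] : x <= s <= y by lra.
  have v0 : velocity g s = 0.
    rewrite -(dc s); last by lra.
    apply: velocity_ext => //; apply: filterS (near_open_itv sxy) => r rxy.
    have /in_e/eP[_ _ ->] // : x <= r <= y by lra.
    lra.
  have spsi : smooth_at (psi : N -> 'rV[R]_(mdim N)) (g s).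
    by apply: smooth_at_chart => //; exact: chart_at_atlas.
  have D0 : derive1 (fun s : R => psi (g s) : 'rV[R]_(mdim N)) s = 0.
    by have := velocity_comp spsi sgs; rewrite v0 linear0; exact.
  rewrite derive1E in D0.
  have df : derivable (fun s => psi (g s)) s (1 : R).
    exact: smooth_at_derivable (smooth_at_comp spsi sgs).
  split; first exact: (derivable_mxP _ _ _).1 df 0 j.
  by have := congr1 (fun w : 'rV[R]_(mdim N) => w 0 j) D0; rewrite derive_mx // !mxE.
have psiE : psi (g x) = psi (g y).
  apply/rowP => j; have [] := @MVT_segment R (fun s => psi (g s) 0 j) (fun=> 0) x y xy.
  - by move=> s; rewrite in_itv /= => /d0.
  - apply: continuous_in_subspaceT => s; rewrite inE /= in_itv /= => /sx ss.
    apply: (@continuous_comp _ _ _ (fun s => psi (g s)) (fun v : 'rV[R]_(mdim N) => v 0 j)).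
      exact: smooth_at_continuous ss.
    exact: coord_continuous.
  by move=> r _ /eqP; rewrite mul0r subr_eq0 => /eqP.
have [_ dx gx] : [/\ smooth_at (M := R^o) g x, chart_dom psi (g x) & a <= x <= b -> g x = c x].
  by apply: eP; apply: in_e; rewrite lexx.
have [_ dy gy] : [/\ smooth_at (M := R^o) g y, chart_dom psi (g y) & a <= y <= b -> g y = c y].
  by apply: eP; apply: in_e; rewrite xy lexx.
rewrite -gx; last by rewrite ax (le_trans xy yb).
rewrite -gy; last by rewrite (le_trans ax xy) yb.
by rewrite -(chart_invK dx) psiE (chart_invK dy).
Qed.

End SmoothOn.

(** * Horizontal curves in a principal bundle *)

Section BundleCurves.
Variables (R : realType) (P M : manifoldType R) (G : lieGroupType R).
Variable B : principal_bundle P M G.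
Local Notation "p ** g" := (pb_act B p g) (at level 40).

Lemma smooth_at_act z : smooth_at (fun z : P * G => z.1 ** z.2) z.
Proof. exact: smooth_smooth_at (pb_act_smooth B). Qed.

Lemma smooth_at_actl g p : smooth_at (fun q : P => q ** g) p.
Proof. exact: (smooth_at_slicel (smooth_at_act (p, g))). Qed.

Lemma smooth_at_actr p g : smooth_at (fun h : G => p ** h) g.
Proof. exact: (smooth_at_slicer (smooth_at_act (p, g))). Qed.

Lemma smooth_at_mulgl (g h : G) : smooth_at (fun k : G => (g * k)%g) h.
Proof. exact: (smooth_at_slicer (smooth_smooth_at (g, h) (@smooth_mulg R G))). Qed.

Lemma smooth_at_mulgr (g h : G) : smooth_at (fun k : G => (k * g)%g) h.
Proof. exact: (smooth_at_slicel (smooth_smooth_at (h, g) (@smooth_mulg R G))). Qed.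

(** Left translation by g inverts left translation by g^-1. *)
Lemma maurer_cartan_inj (g : G) w : tdiff (fun h => (g^-1 * h)%g) g w = 0 -> w = 0.
Proof.
move=> L0; rewrite -[LHS](tdiff_id g w).
have -> : (fun q : G => q) = (fun q : G => (g * (g^-1 * q))%g).
  by apply/funext => q; rewrite mulVKg.
have D := tdiff_comp w (smooth_at_mulgl g (g^-1 * g)%g) (smooth_at_mulgl g^-1%g g).
exact: (etrans D (etrans (congr1 (tdiff (fun k => (g * k)%g) (g^-1 * g)%g) L0) (linear0 _))).
Qed.

Variable om : connection_form B.

(** By equivariance of orbit maps, p ** h = (p ** g) ** (g^-1 * h): the form on the
    orbit directions is the left Maurer-Cartan form of the group. *)
Lemma connection_orbit p (g : G) w :
  om (p ** g) (tdiff (fun h => p ** h) g w) = tdiff (fun h => (g^-1 * h)%g) g w.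
Proof.
have -> : (fun h => p ** h) = (fun h => (p ** g) ** (g^-1 * h)%g).
  by apply/funext => h; rewrite -pb_actM mulVKg.
rewrite (tdiff_comp (f := fun k => (p ** g) ** k)); last exact: smooth_at_mulgl.
  by rewrite mulVg cf_vertical.
exact: smooth_at_actr.
Qed.

(** The Leibniz rule for the action: the translate of c' is governed by equivariance,
    the orbit direction by connection_orbit. *)
Lemma connection_product (c : R -> P) (g : R -> G) (t : R) :
  smooth_at (M := R^o) c t -> smooth_at (M := R^o) g t ->
  om (c t ** g t) (velocity (fun s => c s ** g s) t) =
  Ad ((g t)^-1)%g (om (c t) (velocity c t)) +
  tdiff (fun h => ((g t)^-1 * h)%g) (g t) (velocity g t).
Proof.
move=> sc sg.
rewrite (velocity_pair_comp (F := fun z : P * G => z.1 ** z.2)) //; last exact: smooth_at_act.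
by rewrite linearD /= cf_equivariant connection_orbit.
Qed.

Lemma near_pb_proj (U : set M) (c : R -> P) (t : R) : open U -> U (pb_proj B (c t)) ->
  smooth_at (M := R^o) c t -> \forall s \near t, U (pb_proj B (c s)).
Proof.
move=> oU Ut sc; have sp : smooth_at (fun p => pb_proj B p) (c t).
  exact: smooth_smooth_at (pb_proj_smooth B).
have := smooth_at_continuous (smooth_at_comp sp sc).
by apply; exact: open_nbhs_nbhs.
Qed.

Lemma Ad0 (g : G) : Ad g 0 = 0.
Proof. exact: linear0. Qed.

(** Two horizontal curves over the same base curve differ by a curve in the group;
    its Maurer-Cartan derivative vanishes, so it is constant. *)
Lemma horizontal_rigidity (c1 c2 : R -> P) (a b : R) : a <= b ->
  smooth_on (M := R^o) [set t : R^o | a <= t <= b] c1 ->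
  smooth_on (M := R^o) [set t : R^o | a <= t <= b] c2 ->
  (forall t, a <= t <= b -> pb_proj B (c1 t) = pb_proj B (c2 t)) ->
  (forall t, a < t < b -> om (c1 t) (velocity c1 t) = 0) ->
  (forall t, a < t < b -> om (c2 t) (velocity c2 t) = 0) ->
  exists h : G, c2 a = c1 a ** h /\ c2 b = c1 b ** h.
Proof.
move=> ab s1 s2 p12 h1 h2.
have /choice[g gP] (t : R) : exists h : G, a <= t <= b -> c2 t = c1 t ** h.
  have [/p12/pb_transitive[h hE]|_] := boolP (a <= t <= b); first by exists h.
  by exists 1%g.
suff gab : g a = g b by exists (g a); split; [|rewrite gab]; apply: gP; rewrite lexx ?ab.
have sg : smooth_on (M := R^o) [set t : R^o | a <= t <= b] g.
  apply/smooth_onP => t tab.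
  have [U [tau [sigma [[oU Ux] [stau _] _ _ tauM]]]] := pb_loctriv B (pb_proj B (c1 t)).
  have /smooth_onP/(_ t tab)[d1 sd1 d1E] := s1.
  have /smooth_onP/(_ t tab)[d2 sd2 d2E] := s2.
  have d1t : d1 t = c1 t by exact: (nbhs_singleton d1E).
  have d2t : d2 t = c2 t by exact: (nbhs_singleton d2E).
  have oV : open (pb_proj B @^-1` U).
    apply: open_comp => // p _.
    exact: smooth_at_continuous (smooth_smooth_at _ (pb_proj_smooth B)).
  have tau1 : smooth_at tau (d1 t) by apply: smooth_openP stau oV _ _; rewrite /= d1t.
  have tau2 : smooth_at tau (d2 t).
    by apply: smooth_openP stau oV _ _; rewrite /= d2t -p12.
  (* tau is the group coordinate of a trivialisation, so tau (c2 s) = tau (c1 s) * g s. *)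
  exists (fun s : R^o => ((tau (d1 s))^-1 * tau (d2 s))%g).
    apply: (@smooth_at_comp R R^o _ _ (fun z : G * G => (z.1 * z.2)%g)
      (fun s => ((tau (d1 s))^-1%g, tau (d2 s)))).
      exact: smooth_smooth_at (@smooth_mulg R G).
    apply: smooth_at_pair; last exact: smooth_at_comp.
    apply: (@smooth_at_comp R R^o _ _ (fun g : G => g^-1%g) (fun s => tau (d1 s))).
      exact: smooth_smooth_at (@smooth_invg R G).
    exact: smooth_at_comp.
  have Ud1 : U (pb_proj B (d1 t)) by rewrite d1t.
  have nU := near_pb_proj oU Ud1 sd1.
  apply: filterS2 (filterI d1E d2E) nU => s [E1 E2] Us sab.
  by rewrite (E1 sab) in Us *; rewrite (E2 sab) (gP _ sab) tauM // mulKg.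
apply: (@velocity0_cst R G g a b ab sg) => t tab.
have nab := near_open_itv tab.
have nS : nbhs (t : R^o) [set t : R^o | a <= t <= b].
  by apply: filterS nab => s /= sab; lra.
have sc1 := smooth_on_interior s1 nS; have sc2 := smooth_on_interior s2 nS.
have sgt := smooth_on_interior sg nS.
have E : {near t, c2 =1 (fun s => c1 s ** g s)} by apply: filterS nS => s /gP.
have vE : velocity c2 t = velocity (fun s => c1 s ** g s) t := velocity_ext E sc2.
have c2t : c2 t = c1 t ** g t by apply: gP; lra.
have := connection_product sc1 sgt.
rewrite -vE -c2t (h2 t tab) (h1 t tab) Ad0 add0r => /esym L0.
exact: maurer_cartan_inj L0.
Qed.

End BundleCurves.

(** * Existence of horizontal lifts *)

Section GroupODE.
Variables (R : realType) (G : lieGroupType R).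

Lemma Ck_on_row_mxr m n k (y : 'rV[R]_m) (U : set 'rV[R]_n) j :
  Ck_on k U (fun x : 'rV[R]_n => row_mx y x 0 j).
Proof.
rewrite -(splitK j); case: (fintype.split j) => i /=.
  have -> : (fun x : 'rV[R]_n => row_mx y x 0 (lshift n i)) = (fun=> y 0 i).
    by apply/funext => x; rewrite row_mxEl.
  exact: Ck_on_cst.
have -> : (fun x : 'rV[R]_n => row_mx y x 0 (rshift m i)) = (fun x => x 0 i).
  by apply/funext => x; rewrite row_mxEr.
exact: Cinfty_on_coord.
Qed.

Lemma derive_row_mxl m n (h : 'rV[R]_(m + n) -> R) (y v : 'rV[R]_m) (x : 'rV[R]_n) :
  'D_v (fun y => h (row_mx y x)) y = 'D_(row_mx v 0) h (row_mx y x).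
Proof.
have E : (fun s : R => s^-1 *: (((fun y => h (row_mx y x)) \o shift y) (s *: v) -
      h (row_mx y x))) =
    (fun s : R => s^-1 *: ((h \o shift (row_mx y x)) (s *: row_mx v 0) - h (row_mx y x))).
  by apply/funext => s /=; rewrite scale_row_mx add_row_mx scaler0 add0r.
by rewrite /derive E.
Qed.

Lemma row_mxl_sum m n (v : 'rV[R]_m) :
  row_mx v (0 : 'rV[R]_n) = \sum_i v 0 i *: row_mx (delta_mx 0 i) 0.
Proof.
have rowD : {morph (fun w : 'rV[R]_m => row_mx w (0 : 'rV[R]_n)) : a b / a + b}.
  by move=> a b; rewrite add_row_mx addr0.
rewrite {1}[v]row_sum_delta (big_morph _ rowD (row_mx0 _ _ _ _)).
by apply: eq_bigr => i _; rewrite scale_row_mx scaler0.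
Qed.

(** In the chart chi at the unit, the right-invariant field with value B at the unit has
    components sum_i B_i b i j (x), where b i j is the partial derivative of the j-th
    component of the multiplication with respect to the i-th coordinate of its first
    factor, taken at the unit: the equation g' = A g is a control equation. *)
Lemma group_ode (A : R -> 'rV[R]_(mdim G)) (t0 d : R) : 0 < d ->
  (forall i, Cinfty_on [set u : 'rV[R]_1 | `|u 0 0 - t0| < d] (fun u => A (u 0 0) 0 i)) ->
  exists (e : R) (g : R -> G), 0 < e /\ forall t, `|t - t0| < e ->
    [/\ `|t - t0| < d, smooth_at (M := R^o) g t &
      velocity g t = tdiff (fun h => (h * g t)%g) 1%g (A t)].
Proof.
move=> d0 sA; pose chi := chart_at (1%g : G); pose y0 := chi 1%g.
have achi : atlas chi by exact: chart_at_atlas.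
have d1 : chart_dom chi 1%g by exact: chart_at_dom.
pose mul (z : G * G) := (z.1 * z.2)%g.
pose Phi := prod_chart chi chi.
have aPhi : atlas (Phi : chart R (G * G)%type (mdim (G * G)%type)) by exists (chi, chi).
pose Om : set 'rV[R]_(mdim G + mdim G) := chart_overlap setT mul Phi chi.
pose h j (z : 'rV[R]_(mdim G + mdim G)) := chi (mul (chart_inv Phi z)) 0 j.
have smul : smooth mul by exact: smooth_mulg.
have oOm : open Om by apply: chart_overlap_open; [exact: openT|exact: smul.1].
have sh j : Cinfty_on Om (h j) by exact: (smul.2 Phi chi aPhi achi j).
pose b i j (x : 'rV[R]_(mdim G)) := 'D_(row_mx (delta_mx 0 i) 0) (h j) (row_mx y0 x).
(* The points x of the chart at which multiplication by elements near the unit stays in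
   the chart. *)
pose U : set 'rV[R]_(mdim G) := [set x | Om (row_mx y0 x)].
have oU : open U.
  apply: (@open_comp _ _ (fun x : 'rV[R]_(mdim G) => row_mx y0 x) Om) => // x _.
  apply: rV_continuous => j.
  exact: Ck_on_continuous (@Ck_on_row_mxr _ _ 0%N y0 setT j) x I.
have Uimg x : U x -> chart_img chi x.
  move=> [ix _ _]; move: ix.
  by rewrite /chart_img prod_chart_img /= row_mxKr => -[].
have hE j y x : h j (row_mx y x) = chi (chart_inv chi y * chart_inv chi x)%g 0 j.
  by rewrite /h /mul /Phi /= /prod_chart_inv row_mxKl row_mxKr.
have Uy0 : U y0.
  have iy0 : chart_img chi y0 by exists 1%g.
  split=> //; first by rewrite /chart_img prod_chart_img /= row_mxKl row_mxKr.
  by rewrite /mul /prod_chart_inv /= row_mxKl row_mxKr /y0 chart_invK // mulg1.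
have sb i j : Cinfty_on U (b i j).
  move=> k; apply: (@Ck_on_comp R k _ _ Om U
    (fun z => 'D_(row_mx (delta_mx 0 i) 0) (h j) z) (fun x => row_mx y0 x)) => //.
    by move=> i'; exact: Ck_on_row_mxr.
  exact: Ck_on_derive (sh j k.+1).
have Ac i t : `|t - t0| < d -> {for t, continuous (fun t => A t 0 i)}.
  move=> td; have -> : (fun t => A t 0 i) = (fun u : 'rV[R]_1 => A (u 0 0) 0 i) \o const_mx.
    by apply/funext => s; rewrite /= mxE.
  apply: continuous_comp; first exact: const_mx_continuous.
  by apply: (Ck_on_continuous (sA i 0%N)); rewrite /= mxE.
have [e [x [e0 xt0 xP]]] := control_ode oU Uy0 d0 Ac (fun i j => sb i j 1%N).
have sx : forall t, `|t - t0| < e -> smooth_at (M := R^o) x t.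
  apply: smooth_at_rV_curve => j.
  apply: (@control_ode_smooth R _ _ (fun i t => A t 0 i) b U) => //.
    by move=> i; apply: Cinfty_on_sub (sA i) => u /xP[].
  by move=> t /xP[].
exists e, (fun t => chart_inv chi (x t)); split=> // t te.
have [td Ux dx] := xP t te; have ix := Uimg _ Ux.
have sinv := smooth_at_chart_inv achi ix.
split=> //; first by apply: (@smooth_at_comp R R^o) => //; exact: sx.
set g := chart_inv chi (x t).
rewrite (velocity_comp sinv (sx t te)).
have dg : chart_dom chi g by exact: (chart_img_invP ix).1.
have chig : chi g = x t by exact: (chart_img_invP ix).2.
have d1g : chart_dom chi (1 * g)%g by rewrite mul1g.
have sR : smooth_at (fun k : G => (k * g)%g) 1%g by exact: smooth_at_mulgr.
have schi := smooth_at_chart achi d1g.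
have schiR : smooth_at (fun k : G => chi (k * g)%g) 1%g.
  exact: (@smooth_at_comp R G G _ chi (fun k : G => (k * g)%g) 1%g schi sR).
have sinv' : smooth_at (chart_inv chi) (chi (1 * g)%g) by rewrite mul1g chig.
have E : {near (1%g : G), (fun k : G => chart_inv chi (chi (k * g)%g)) =1 (fun k => (k * g)%g)}.
  have nE : \forall k \near (1%g : G), chart_dom chi (k * g)%g.
    exact: (smooth_at_continuous sR (near_chart_dom d1g)).
  by apply: filterS nE => k dk; rewrite chart_invK.
have RE : tdiff (fun k : G => (k * g)%g) 1%g (A t) =
    tdiff (chart_inv chi) (x t) (tdiff (fun k : G => chi (k * g)%g) 1%g (A t)).
  have sE : smooth_at (fun k : G => chart_inv chi (chi (k * g)%g)) 1%g.
    exact: (@smooth_at_comp R _ _ _ (chart_inv chi) (fun k : G => chi (k * g)%g)).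
  have RE1 := tdiff_ext (A t) E sE.
  apply: (etrans (esym RE1)).
  have := @tdiff_comp R _ _ _ (chart_inv chi) (fun k : G => chi (k * g)%g) _ (A t) sinv' schiR.
  by rewrite mul1g chig.
apply: etrans (esym RE); congr (tdiff _ _ _); rewrite (tdiff_rVE _ schiR) -/chi -/y0.
have -> : velocity x t = \row_j 'D_(1 : R) (fun s => x s 0 j) t.
  rewrite /velocity derive1E; have dxt := smooth_at_derivable (sx t te).
  change ('D_(1 : R) x t = \row_j 'D_(1 : R) (fun s => x s 0 j) t).
  by rewrite derive_mx //; apply/rowP => j; rewrite !mxE.
apply/rowP => j; rewrite !mxE; have [_ ->] := dx j.
have Omx : Om (row_mx y0 (x t)) by exact: Ux.
have dh : differentiable (h j) (row_mx y0 (x t)).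
  by apply: C1_differentiable Omx => //; exact: (sh j 1%N).
have -> : (fun y => chi (chart_inv chi y * g)%g 0 j) = (fun y => h j (row_mx y (x t))).
  by apply/funext => y; rewrite hE.
rewrite derive_row_mxl (deriveE _ dh) row_mxl_sum linear_sum.
by apply: eq_bigr => i _; rewrite linearZ /= -deriveE.
Qed.

End GroupODE.

Section Lifts.
Variables (R : realType) (P M : manifoldType R) (G : lieGroupType R).
Variables (B : principal_bundle P M G) (om : connection_form B).
Local Notation "p ** g" := (pb_act B p g) (at level 40).

Definition lifts_at (beta : R -> M) (c : R -> P) (t : R) : Prop :=
  [/\ smooth_at (M := R^o) c t, pb_proj B (c t) = beta t & om (c t) (velocity c t) = 0].

Lemma lifts_at_ext beta (c c' : R -> P) (t : R) :
  {near t, c =1 c'} -> lifts_at beta c t -> lifts_at beta c' t.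
Proof.
move=> E [sc pc hc]; have ct : c t = c' t by exact: (nbhs_singleton E).
have vE : velocity c t = velocity c' t := velocity_ext E sc.
by rewrite ct vE in pc hc; split=> //; exact: (@smooth_at_ext R R^o _ c c' t E sc).
Qed.

Lemma lifts_at_act beta (c : R -> P) (t : R) g :
  lifts_at beta c t -> lifts_at beta (fun s => c s ** g) t.
Proof.
move=> [sc pc hc]; have sg := smooth_at_actl B g (c t).
split; first exact: (@smooth_at_comp R R^o _ _ (fun q => q ** g) c).
  by rewrite pb_proj_act.
have vE : velocity (fun s => c s ** g) t = tdiff (fun q => q ** g) (c t) (velocity c t).
  exact: (velocity_comp sg sc).
by rewrite vE cf_equivariant hc Ad0.
Qed.

Lemma tdiff_mul_Ad (g : G) w :
  tdiff (fun h => (g^-1 * h)%g) g (tdiff (fun h => (h * g)%g) 1%g w) = Ad (g^-1)%g w.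
Proof.
have D := @tdiff_comp R G G G (fun h => (g^-1 * h)%g) (fun h => (h * g)%g) 1%g w
  (smooth_at_mulgl _ _) (smooth_at_mulgr _ _).
rewrite mul1g in D.
have fE : (fun h => (g^-1 * (h * g))%g) = (fun h => (g^-1 * h * (g^-1)^-1)%g).
  by apply/funext => h; rewrite mulgA invgK.
exact: (etrans (esym D) (congr1 (fun f : G -> G => tdiff f 1%g w) fE)).
Qed.

(** A local section s is corrected by a curve g in the group: s ** g is horizontal
    when g solves the right-invariant equation driven by minus the form of s. *)
Lemma local_lift (beta : R -> M) (t0 : R) : smooth_at (M := R^o) beta t0 ->
  exists (e : R) (c : R -> P), 0 < e /\ forall t, `|t - t0| < e -> lifts_at beta c t.
Proof.
move=> sbeta.
have [U [tau [sigma [[oU Ut0] [_ ssig] _ sigP _]]]] := pb_loctriv B (beta t0).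
pose s t := sigma (beta t, 1%g).
have oV : open (U `*` [set: G]).
  rewrite openE => -[y h] [/= Uy _]; exists (U, setT) => //=.
  by split; [apply: open_nbhs_nbhs|exact: filterT].
have ss t : smooth_at (M := R^o) beta t -> U (beta t) -> smooth_at (M := R^o) s t.
  move=> sb Ub; apply: (@smooth_at_comp R R^o _ _ sigma (fun t => (beta t, 1%g))).
    exact: smooth_openP ssig oV _ _.
  by apply: smooth_at_pair => //; exact: smooth_at_cst.
have [d1 d10 Ad1] := smooth_form_velocity (cf_smooth om) (ss _ sbeta Ut0).
have [d2 d20 d2P] : exists2 d : R, 0 < d & forall t, `|t - t0| <= d ->
    smooth_at (M := R^o) beta t /\ U (beta t).
  apply: near_closed_ball.
  have n1 : \forall t \near t0, smooth_at (M := R^o) beta t by exact: (smooth_at_near sbeta).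
  have n2 : \forall t \near t0, U (beta t).
    by apply: (smooth_at_continuous sbeta); exact: open_nbhs_nbhs.
  by apply: filterS2 n1 n2 => t; split.
pose A t := - om (s t) (velocity s t).
have sA i : Cinfty_on [set u : 'rV[R]_1 | `|u 0 0 - t0| < d1] (fun u => A (u 0 0) 0 i).
  move=> k; have oW : open [set u : 'rV[R]_1 | `|u 0 0 - t0| < d1] by exact: open_time_ball.
  apply: (Ck_on_ext oW _ (Ck_onM oW (Ck_on_cst k _ (-1)) (Ad1 i k))) => u _.
  by rewrite /A mxE mulN1r.
have [e [g [e0 gP]]] := group_ode d10 sA.
exists (Num.min e d2), (fun t => s t ** g t); split; first by rewrite lt_min e0.
move=> t; rewrite lt_min => /andP[te /ltW/d2P[sbt Ut]].
have [_ sg gE] := gP t te; have st := ss t sbt Ut.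
split.
- apply: (@smooth_at_comp R R^o _ _ (fun z : P * G => z.1 ** z.2) (fun t => (s t, g t))).
    exact: smooth_at_act.
  exact: smooth_at_pair.
- by rewrite pb_proj_act; exact: (sigP _ _ Ut).1.
have := connection_product om st sg; rewrite gE => ->.
have -> : tdiff (fun h => ((g t)^-1 * h)%g) (g t) (tdiff (fun h => (h * g t)%g) 1%g (A t)) =
    - Ad ((g t)^-1)%g (om (s t) (velocity s t)).
  by apply: etrans (tdiff_mul_Ad _ _) _; rewrite /A /Ad; exact: linearN.
exact: subrr.
Qed.

Lemma lifts_at_segment beta c (a b : R) : (forall t, a <= t <= b -> lifts_at beta c t) ->
  smooth_on (M := R^o) [set t : R^o | a <= t <= b] c.
Proof. by move=> lc; apply: smooth_at_smooth_on => t /lc[]. Qed.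

Lemma lifts_unique beta (c1 c2 : R -> P) (a b : R) : a <= b ->
  (forall t, a <= t <= b -> lifts_at beta c1 t) ->
  (forall t, a <= t <= b -> lifts_at beta c2 t) ->
  c1 a = c2 a <-> c1 b = c2 b.
Proof.
move=> ab l1 l2.
have [|t tab|t tab|h [ha hb]] := horizontal_rigidity (om := om) ab
  (lifts_at_segment l1) (lifts_at_segment l2).
- by move=> t tab; have [_ -> _] := l1 t tab; have [_ -> _] := l2 t tab.
- by have [|_ _ ->] := l1 t; first lra.
- by have [|_ _ ->] := l2 t; first lra.
have fix1 p : p = p ** h -> h = 1%g.
  by move=> ph; apply: (@pb_free _ _ _ _ B p); rewrite pb_act1.
by split=> E; [move: ha; rewrite -E|move: hb; rewrite -E] => /fix1 h1;
  rewrite ?hb ?ha h1 pb_act1.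
Qed.

(** The margin e around the segment is what allows smooth gluing: lifts over adjacent
    segments overlap on an open interval. *)
Definition liftable (beta : R -> M) (a b : R) : Prop :=
  forall p, pb_proj B p = beta a -> exists (e : R) (c : R -> P),
    [/\ 0 < e, c a = p & forall t, a - e < t < b + e -> lifts_at beta c t].

(** The second lift starts where the first one arrives; by uniqueness they agree on the
    whole overlap, so switching from one to the other is smooth. *)
Lemma liftable_trans beta (a b c : R) : a <= b -> b <= c ->
  liftable beta a b -> liftable beta b c -> liftable beta a c.
Proof.
move=> ab bc l1 l2 p pa; have [e1 [c1 [e10 c1a c1P]]] := l1 p pa.
have [|e2 [c2 [e20 c2b c2P]]] := l2 (c1 b).
  by have [|_ -> _] := c1P b; first lra.
pose e := Num.min e1 e2.
have e0 : 0 < e by rewrite lt_min e10.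
have ee1 : e <= e1 by rewrite ge_min lexx.
have ee2 : e <= e2 by rewrite ge_min lexx orbT.
have c12 t : b - e < t < b + e -> c1 t = c2 t.
  move=> tb; have [tb1|/ltW tb1] := leP t b.
    apply/(lifts_unique tb1 (beta := beta) (c1 := c1) (c2 := c2)) => // s sb.
    - by apply: c1P; lra.
    - by apply: c2P; lra.
  apply/(lifts_unique tb1 (beta := beta) (c1 := c1) (c2 := c2)) => // s sb.
  - by apply: c1P; lra.
  - by apply: c2P; lra.
exists e, (fun s => if s < b then c1 s else c2 s); split=> //.
  case: ltP => // ba; have aE : a = b by lra.
  by rewrite [in LHS]aE c2b -aE c1a.
move=> t tac; have [tb|bt] := ltP t b.
  apply: (@lifts_at_ext beta c1); last by apply: c1P; lra.
  have nb : \forall s \near t, a - e - 1 < s < b by apply: near_open_itv; lra.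
  by apply: filterS nb => s /andP[_ ->].
apply: (@lifts_at_ext beta c2); last by apply: c2P; lra.
have nb : \forall s \near t, b - e < s < c + e by apply: near_open_itv; lra.
by apply: filterS nb => s sb; case: ltP => // sb1; rewrite c12 //; lra.
Qed.

(** A translate of one local lift passes through any given point of the fibre, so the
    length of the segment does not depend on that point. *)
Lemma liftable_local beta (t : R) : smooth_at (M := R^o) beta t ->
  exists2 e : R, 0 < e & forall a b : R, a <= b -> t - e < a -> b < t + e -> liftable beta a b.
Proof.
move=> sb; have [e [c [e0 cP]]] := local_lift sb.
exists (e / 2); first by rewrite divr_gt0.
move=> a b ab ta bt p pa.
have [|_ ca _] := cP a; first by rewrite ltr_norml; lra.
have [g gE] : exists g, p = c a ** g by apply: pb_transitive; rewrite ca pa.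
exists (e / 2), (fun s => c s ** g); split=> //; first by rewrite divr_gt0.
by move=> s sab; apply: lifts_at_act; apply: cP; rewrite ltr_norml; lra.
Qed.

Lemma liftable_segment beta (a b : R) : a <= b ->
  (forall t, smooth_at (M := R^o) beta t) -> liftable beta a b.
Proof.
move=> ab sb; apply: segment_chain ab _ _ => [x y z _ xy yz _|t _].
  exact: liftable_trans.
have [e e0 eP] := liftable_local (sb t).
by exists e => // x y _ xy _; exact: eP.
Qed.

(** The sitting instants make the path, frozen outside the unit interval, smooth on
    the whole line. *)
Lemma path_extension (alpha : R -> M) x y : path_from_to alpha x y ->
  forall t, smooth_at (M := R^o) (fun t => alpha (clamp 0 1 t)) t.
Proof.
move=> [sa [e /andP[e0 e1] [ax ay]]] t.
have [te|et] := ltP t e.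
  apply: (@smooth_at_ext R R^o _ (fun=> x)); last exact: smooth_at_cst.
  have nt : \forall s \near t, t - 1 < s < e by apply: near_open_itv; lra.
  apply: filterS nt => s se; apply/esym/ax.
  have [s0|/ltW s0] := leP s 0; last by rewrite clamp_id; lra.
  by rewrite /clamp (min_idPr _) ?(max_idPl _); lra.
have [te|et'] := ltP (1 - e) t.
  apply: (@smooth_at_ext R R^o _ (fun=> y)); last exact: smooth_at_cst.
  have nt : \forall s \near t, 1 - e < s < t + 1 by apply: near_open_itv; lra.
  apply: filterS nt => s se; apply/esym/ay.
  have [s1|/ltW s1] := leP s 1; first by rewrite clamp_id; lra.
  by rewrite /clamp (min_idPl s1) (max_idPr _); lra.
have n01 : \forall s \near t, 0 < s < 1 by apply: near_open_itv; lra.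
have nS : nbhs (t : R^o) [set t : R^o | 0 <= t <= 1].
  by apply: filterS n01 => s /= ?; lra.
apply: (@smooth_at_ext R R^o _ alpha); last exact: (smooth_on_interior sa nS).
by apply: filterS nS => s s01; rewrite clamp_id.
Qed.

Lemma horizontal_lift_exists (alpha : R -> M) x y p : path_from_to alpha x y ->
  pb_proj B p = x -> exists c, horizontal_lift om alpha c /\ c 0 = p.
Proof.
move=> axy px; have [_ [e /andP[e0 _] [ax _]]] := axy.
pose beta t := alpha (clamp 0 1 t).
have bE t : 0 <= t <= 1 -> beta t = alpha t by move=> t01; rewrite /beta clamp_id.
have [|d [c [d0 c0 cP]]] := liftable_segment ler01 (path_extension axy) (p := p).
  by rewrite -/(beta 0) bE ?lexx ?ler01 // ax // lexx ltW.
exists c; split=> //; split.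
- by apply: (lifts_at_segment (beta := beta)) => t t01; apply: cP; lra.
- by move=> t t01; rewrite -bE //; have [|_ ->] := cP t; first lra.
- by move=> t t01; have [|_ _ ->] := cP t; first lra.
Qed.

Lemma horizontal_lift_rigid (beta : R -> M) c1 c2 :
  horizontal_lift om beta c1 -> horizontal_lift om beta c2 ->
  exists g : G, c2 0 = c1 0 ** g /\ c2 1 = c1 1 ** g.
Proof.
move=> [s1 p1 h1] [s2 p2 h2].
by apply: horizontal_rigidity ler01 s1 s2 _ h1 h2 => t t01; rewrite p1 ?p2.
Qed.

Lemma transportE (beta : R -> M) c :
  horizontal_lift om beta c -> transport om beta (c 0) = c 1.
Proof.
move=> lc; rewrite /transport; case: xgetP => [q _ [c' [lc' c0 <-]]|/(_ (c 1))]; last first.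
  by case; exists c.
have [g [g0 g1]] := horizontal_lift_rigid lc lc'.
have -> : c' 1 = c 1 ** g by [].
suff -> : g = 1%g by rewrite pb_act1.
by apply: (@pb_free _ _ _ _ B (c 0)); rewrite -g0 c0 pb_act1.
Qed.

Section Transport.
Variables (alpha : R -> M) (x y : M).
Hypothesis alpha_xy : path_from_to alpha x y.

Lemma path_ends : alpha 0 = x /\ alpha 1 = y.
Proof.
have [_ [e /andP[e0 e1] [ax ay]]] := alpha_xy.
by split; [apply: ax|apply: ay]; lra.
Qed.

Lemma transport_proj p : pb_proj B p = x -> pb_proj B (transport om alpha p) = y.
Proof.
move=> px; have [c [lc c0]] := horizontal_lift_exists alpha_xy px.
rewrite -c0 (transportE lc); have [_ pc _] := lc.
by rewrite pc ?path_ends.2 // lexx ler01.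
Qed.

(** By rigidity the element that relates two lifts at time 0 relates them at time 1. *)
Lemma transport_act p g : pb_proj B p = x ->
  transport om alpha (p ** g) = transport om alpha p ** g.
Proof.
move=> px; have [c [lc c0]] := horizontal_lift_exists alpha_xy px.
have [|c' [lc' c0']] := horizontal_lift_exists alpha_xy (p := p ** g).
  by rewrite pb_proj_act.
rewrite -c0' (transportE lc') -c0 (transportE lc).
have [h [h0 ->]] := horizontal_lift_rigid lc lc'; congr (_ ** _).
by apply: (@pb_free _ _ _ _ B (c 0)); rewrite -h0 c0' c0.
Qed.

End Transport.


End Lifts.

(** * Fibres of associated bundles in moving frames *)

Section FrameMap.
Variables (R : realType) (P M : manifoldType R) (G : lieGroupType R).
Variables (B : principal_bundle P M G) (V : vectType R) (rho : lie_rep G V).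
Variables (x y : M) (p q : P) (px : pb_proj B p = x) (qy : pb_proj B q = y).

(** Each of the frames p and q identifies a fibre with V; the representative that is
    chosen is unique by fclsP. *)
Definition frame_map (a : afib B rho x) : afib B rho y :=
  fcls rho (projT1 (cid (fcls_surj px a))) qy.

Lemma frame_mapE v : frame_map (fcls rho v px) = fcls rho v qy.
Proof. by rewrite /frame_map; case: cid => w /= /fclsP <-. Qed.

Fact frame_map_linear : linear frame_map.
Proof.
move=> k a b; have [v ->] := fcls_surj px a; have [w ->] := fcls_surj px b.
by rewrite -fcls_linear !frame_mapE fcls_linear.
Qed.
HB.instance Definition _ := GRing.isLinear.Build R (afib B rho x) (afib B rho y) _
  frame_map frame_map_linear.

Lemma acls_act r g v : acls B rho (pb_act B r g) v = acls B rho r (rho g v).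
Proof. by apply/esym/aclsP; exists g; rewrite -repM mulVg rep1. Qed.

(** A frame r over x has the form p g, so [r, v] = [p, g v]; this goes to
    [f p, g v] = [f p g, v] = [f r, v]. *)
Lemma frame_map_equivariant (f : P -> P) : f p = q ->
  (forall g, f (pb_act B p g) = pb_act B (f p) g) ->
  forall r v (rx : pb_proj B r = x), val (frame_map (fcls rho v rx)) = acls B rho (f r) v.
Proof.
move=> fp fact r v rx.
have [g rE] : exists g, r = pb_act B p g by apply: pb_transitive; rewrite px rx.
have -> : fcls rho v rx = fcls rho (rho g v) px.
  by apply: val_inj; rewrite !val_fcls rE acls_act.
by rewrite frame_mapE val_fcls rE fact acls_act fp.
Qed.

End FrameMap.

Arguments frame_map {R P M G B V} rho {x y p q} px qy a.
Arguments frame_mapE {R P M G B V} rho {x y p q} px qy v.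

Section FrameMapCancel.
Variables (R : realType) (P M : manifoldType R) (G : lieGroupType R).
Variables (B : principal_bundle P M G) (V : vectType R) (rho : lie_rep G V).

Lemma frame_mapK x y p q (px : pb_proj B p = x) (qy : pb_proj B q = y) :
  cancel (frame_map rho px qy) (frame_map rho qy px).
Proof. by move=> a; have [v ->] := fcls_surj px a; rewrite !frame_mapE. Qed.

End FrameMapCancel.

Section FibreMap.
Variables (R : realType) (G : lie_2group R) (X : lie_groupoid R).
Variables (E : principal_2bundle G X) (V : two_vect R) (rho : two_rep G V).

Section Construction.
Variables (x y : obj X) (p q : objE E).
Variables (px : pb_proj (bundle0 E) p = x) (qy : pb_proj (bundle0 E) q = y).

Let f1 := frame_map (trep1 rho) (proj_unit px) (proj_unit qy).
Let f0 := frame_map (trep0 rho) px qy.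

Fact fibre_map_src a : fsrc (f1 a) = f0 (fsrc a).
Proof.
by have [z ->] := fcls_surj (proj_unit px) a; rewrite /f1 /f0 frame_mapE !fsrcE frame_mapE.
Qed.

Fact fibre_map_tgt a : ftgt (f1 a) = f0 (ftgt a).
Proof.
by have [z ->] := fcls_surj (proj_unit px) a; rewrite /f1 /f0 frame_mapE !ftgtE frame_mapE.
Qed.

Fact fibre_map_unit a : f1 (funit a) = funit (f0 a).
Proof.
by have [v ->] := fcls_surj px a; rewrite /f1 /f0 (frame_mapE (trep0 rho) px) !funitE frame_mapE.
Qed.

Fact fibre_map_comp a b : fsrc a = ftgt b -> f1 (fcomp a b) = fcomp (f1 a) (f1 b).
Proof.
have [z ->] := fcls_surj (proj_unit px) a; have [w ->] := fcls_surj (proj_unit px) b.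
rewrite fsrcE ftgtE => /fclsP zw.
by rewrite /f1 !frame_mapE !fcompE // frame_mapE.
Qed.

Definition fibre_map : two_vect_mor (fibre E rho x) (fibre E rho y) :=
  @TwoVectMor R (fibre E rho x) (fibre E rho y) f1 f0
    fibre_map_src fibre_map_tgt fibre_map_unit fibre_map_comp.

End Construction.

Lemma fibre_map_iso x y p q (px : pb_proj (bundle0 E) p = x) (qy : pb_proj (bundle0 E) q = y) :
  two_vect_iso (fibre_map px qy).
Proof. by exists (fibre_map qy px); split; exact: frame_mapK. Qed.

End FibreMap.

(** * Transport along a path of units *)

Section UnitTransport.
Variables (R : realType) (G : lie_2group R) (X : lie_groupoid R).
Variables (E : principal_2bundle G X) (om : strict_connection E).
Variables (alpha : R -> obj X) (x y : obj X).
Hypothesis alpha_xy : path_from_to alpha x y.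

Lemma unit_path : path_from_to (gunit X \o alpha) (gunit X x) (gunit X y).
Proof.
have [sa [e e01 [ax ay]]] := alpha_xy; split.
  apply: (smooth_on_comp sa) => t _.
  exact: smooth_smooth_at (gunit_smooth X).
by exists e => //; split=> t te /=; [rewrite ax|rewrite ay].
Qed.

(** The unit map of the total groupoid is compatible with the projections and, by
    functoriality of the connection, with the connection forms; it therefore sends
    horizontal lifts to horizontal lifts. *)
Lemma unit_horizontal_lift c : horizontal_lift (om0 om) alpha c ->
  horizontal_lift (om1 om) (gunit X \o alpha) (gunit E \o c).
Proof.
move=> [sc pc hc]; have su p : smooth_at (gunit E) p by exact: smooth_smooth_at (gunit_smooth E).
split.
- exact: (smooth_on_comp sc).
- by move=> t t01; rewrite /= (functor_unit (proj_functor E)) pc.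
move=> t t01; have nS : nbhs (t : R^o) [set t : R^o | 0 <= t <= 1].
  by apply: filterS (near_open_itv t01) => s /= ?; lra.
have sct := smooth_on_interior sc nS.
have vE : velocity (gunit E \o c) t = tdiff (gunit E) (c t) (velocity c t).
  exact: (velocity_comp (su _) sct).
by rewrite vE om_unit hc //; exact: linear0.
Qed.

Lemma transport_unit p : pb_proj (bundle0 E) p = x ->
  transport (om1 om) (gunit X \o alpha) (gunit E p) = gunit E (transport (om0 om) alpha p).
Proof.
move=> px; have [c [lc c0]] := horizontal_lift_exists (om0 om) alpha_xy px.
rewrite -c0 (transportE lc).
exact: (transportE (unit_horizontal_lift lc)).
Qed.

End UnitTransport.

Theorem proposition6p7 (R : realType) (G : lie_2group R) (X : lie_groupoid R)
    (E : principal_2bundle G X) (C : quasi_connection E)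
    (om : strict_connection E) (V : two_vect R) (rho : two_rep G V)
    (alpha : R -> obj X) (x y : obj X) (alpha_xy : path_from_to alpha x y) :
  exists T : two_vect_mor (fibre E rho x) (fibre E rho y),
    [/\ two_vect_iso T,
        forall (p : objE E) (v : objv V) (px : pb_proj (bundle0 E) p = x),
          val (mor0 T (fcls (trep0 rho) v px) : afib (bundle0 E) (trep0 rho) y) =
          acls (bundle0 E) (trep0 rho) (transport (om0 om) alpha p) v &
        forall (d : arrE E) (z : arrv V) (dx : pb_proj (bundle1 E) d = gunit X x),
          val (mor1 T (fcls (trep1 rho) z dx)
                 : afib (bundle1 E) (trep1 rho) (gunit X y)) =
          acls (bundle1 E) (trep1 rho) (transport (om1 om) (gunit X \o alpha) d) z].
Proof.
have px := fbaseP (bundle0 E) x; set p := fbase _ _ in px.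
have qy := transport_proj (om0 om) alpha_xy px.
exists (fibre_map rho px qy); split; first exact: fibre_map_iso.
- move=> r v rx; apply: frame_map_equivariant => // g.
  exact: (transport_act (om0 om) alpha_xy).
- move=> d z dx; apply: frame_map_equivariant => [|g]; first exact: (transport_unit om alpha_xy px).
  by apply: (transport_act (om1 om) (unit_path alpha_xy)); exact: proj_unit.
Qed.
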